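(* Let $P$ be an orthogonal polygon with $n \geq 6$ sides. Then there exists a cooperative half-guard set ${\tt G}$ for $P$ with $|{\tt G}| = n/2 - 2$.
   Context: A polygon means a simple closed polygon, viewed as a closed region (boundary plus interior). It is orthogonal if the interior angle at every vertex is $90^\circ$ or $270^\circ$ (so $n$ is even). A half-guard in $P$ is a pair ${\tt g} = (x_{\tt g}, H_{\tt g})$ with $x_{\tt g} \in P$ and $H_{\tt g}$ a closed half-plane whose boundary line contains $x_{\tt g}$. ${\tt g}$ sees $y \in P$ if the segment $\overline{x_{\tt g} y} \subseteq P \cap H_{\tt g}$; ${\tt g}$ sees a half-guard ${\tt h}$ if it sees $x_{\tt h}$. A set ${\tt G}$ of half-guards monitors $P$ if every point of $P$ is seen by some member of ${\tt G}$. The mutual visibility graph $V_{\tt G}$ has vertices ${\tt G}$ and an edge between ${\tt g},{\tt h}$ iff each sees the other. ${\tt G}$ is a cooperative half-guard set for $P$ if it monitors $P$ and $V_{\tt G}$ is connected. *)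

(* Defs.v *)
From HB Require Import structures.
From Stdlib Require Export Relation_Operators.
From mathcomp Require Export all_boot all_order all_algebra.
From mathcomp Require Export all_classical all_reals all_analysis.

Set Implicit Arguments.
Unset Strict Implicit.
Unset Printing Implicit Defensive.

Import Order.TTheory GRing.Theory Num.Theory.
Import numFieldNormedType.Exports.
Local Open Scope classical_set_scope.
Local Open Scope ring_scope.

Section Plane.
Variable R : realType.
Implicit Types (x y a : R * R) (P H : set (R * R)).

Definition segment x y : set (R * R) :=
  [set (1 - t) *: x + t *: y | t in `[0, 1]].

Definition dotp x y : R := x.1 * y.1 + x.2 * y.2.

Definition rotate (t : R) x : R * R :=
  (cos t * x.1 - sin t * x.2, sin t * x.1 + cos t * x.2).

Section Polygon.
Variables (n : nat) (v : 'I_n -> R * R).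

(* Vertices are in cyclic order: [ordS] and [ord_pred] wrap around mod n. *)
Definition side (i : 'I_n) : set (R * R) := segment (v i) (v (ordS i)).

Definition simple_polygon : Prop :=
  [/\ (3 <= n)%N,
      forall i, v i <> v (ordS i),
      forall i, side i `&` side (ordS i) = [set v (ordS i)]
    & forall i j, i <> j -> j <> ordS i -> i <> ordS j ->
        side i `&` side j = set0].

Definition polygon_boundary : set (R * R) := \bigcup_i side i.

(* The bounded side of the closed curve, in the sense of Jordan: the points off
   the curve whose component in the complement of the curve is bounded. *)
Definition polygon_interior : set (R * R) :=
  [set x | (~` polygon_boundary) x /\
           bounded_set (connected_component (~` polygon_boundary) x)].

Definition polygon_region : set (R * R) := polygon_boundary `|` polygon_interior.

(* [th] is the angle swept, inside the polygon, when rotating the side leaving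
   [v i] onto the side entering it. Exactly one of the two senses of rotation
   (the sign [s]) stays inside, depending on the orientation of [v]. *)
Definition interior_angle (i : 'I_n) (th : R) : Prop :=
  0 < th < 2 * pi /\
  exists s : bool,
    let w := v (ordS i) - v i in
    (exists2 rho : R, 0 < rho &
       v (ord_pred i) - v i = rho *: rotate ((-1) ^+ s * th) w) /\
    (forall t : R, 0 < t < th ->
       \forall r \near 0^'+,
         polygon_interior (v i + r *: rotate ((-1) ^+ s * t) w)).

Definition orthogonal_polygon : Prop :=
  simple_polygon /\
  forall i, interior_angle i (pi / 2) \/ interior_angle i (3 * pi / 2).

End Polygon.

(* [g.1] is the position of the guard and [g.2] its half-plane. The half-plane
   is kept as a set of points, so that equality of half-guards, hence the
   cardinality of a set of them, does not depend on the choice of a normal. *)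
Definition guard : Type := ((R * R) * set (R * R))%type.
Implicit Types (g h : guard) (G : set guard).

Definition half_guard P g : Prop :=
  P g.1 /\
  exists a (c : R),
    [/\ a <> 0, g.2 = [set y | c <= dotp a y] & dotp a g.1 = c].

Definition sees P g y : Prop := segment g.1 y `<=` P `&` g.2.

Definition monitors P G : Prop :=
  forall y, P y -> exists2 g, G g & sees P g y.

Definition mutually_visible P g h : Prop := sees P g h.1 /\ sees P h g.1.

Definition visibility_graph_connected P G : Prop :=
  forall g h, G g -> G h ->
    clos_refl_trans guard
      (fun g1 g2 => [/\ G g1, G g2 & mutually_visible P g1 g2]) g h.

Definition cooperative_half_guard_set P G : Prop :=
  [/\ forall g, G g -> half_guard P g,
      monitors P G
    & visibility_graph_connected P G].

End Plane.

(* Main.v *)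
(** In coordinates along the sides, cut the polygon by the vertical chord issued
    from each reflex vertex away from its notch, and put at the other end of the
    chord a half-guard looking back towards the vertex. Every maximal rectangle
    between consecutive chords has such guards on its vertical sides, and an
    upward guard sees every downward one standing higher in the same rectangle:
    hence each rectangle is covered, its guards are linked, and adjacent
    rectangles share a guard. There are n/2 - 2 reflex vertices, because the
    convex ones exceed them by 4 times the Euler characteristic of the region.
    Ranking the coordinates turns the polygon into a lattice polygon, whose
    inside is given by the even-odd rule; walking along the boundary shows that
    the inside and the outside are both connected. *)
Require Import Defs.
From mathcomp Require Import all_boot all_order all_algebra.
From mathcomp Require Import all_classical all_reals all_analysis.
From mathcomp Require Import zify ring lra.

Set Implicit Arguments.
Unset Strict Implicit.
Unset Printing Implicit Defensive.

Import Order.TTheory GRing.Theory Num.Theory.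
Import numFieldNormedType.Exports.

(** * Euler's relation for sets of grid cells *)

(** Exact counts are replaced by bounds. Euler's relation enters as [V - E + F >= 1], obtained from
    linear algebra over the field with two elements. Each cell has four corners, whence the surplus
    of 4 convex vertices and the bound [2 * r + 4 <= n] on the number [r] of reflex points. The
    chords then give at most [maxn 1 r] half-guards, the 1 being for a region without reflex point.
    As [6 <= n], this is at most [n/2 - 2], and the exact cardinality is reached by adding tilted
    half-guards at an occupied position. Connectedness of a set of cells is stated as an induction
    principle: a property preserved between adjacent cells of the set spreads over the set. No path
    of cells is ever built. The principle for the outside gives both the Euler bound and the
    unbounded component of the complement; the one for the inside carries coverage and visibility
    links from one rectangle to the next. *)

Section Cells.
Variables (N : nat) (I : nat -> nat -> bool).

Definition cells_in_box : Prop :=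
  (forall x y, I x y -> [&& 0 < x, 0 < y, x < N & y < N]).

Definition adjacency_invariant (J : nat -> nat -> bool) (Q : nat -> nat -> Prop) :=
  (forall x y, J x y -> J x.+1 y -> (Q x y <-> Q x.+1 y)) /\
  (forall x y, J x y -> J x y.+1 -> (Q x y <-> Q x y.+1)).

(** The cell (0, 0) is outside by [cells_in_box], so it serves as base point of the complement. *)
Definition co_connected : Prop := forall Q,
  adjacency_invariant (fun x y => ~~ I x y) Q ->
  Q 0 0 -> forall x y, ~~ I x y -> Q x y.

Hypotheses (boxI : cells_in_box) (coI : co_connected).

(* Edges and vertices are indexed by a cell: [hedge x y] is its upper edge,
   [vedge x y] its right one and [corner_pt x y] its upper right vertex. *)
Definition hedge x y := I x y || I x y.+1.
Definition vedge x y := I x y || I x.+1 y.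
Definition corner_pt x y := [|| I x y, I x.+1 y, I x y.+1 | I x.+1 y.+1].
Definition quad x y : nat := I x y + I x.+1 y + I x y.+1 + I x.+1 y.+1.

Lemma cells0x y : I 0 y = false.
Proof. by apply/negP => /boxI. Qed.
Lemma cellsx0 x : I x 0 = false.
Proof. by apply/negP => /boxI /and4P[]. Qed.
Lemma cellsNx x y : N <= x -> I x y = false.
Proof. by move=> h; apply/negP => /boxI; lia. Qed.
Lemma cellsxN x y : N <= y -> I x y = false.
Proof. by move=> h; apply/negP => /boxI; lia. Qed.

Lemma cells_lt x y : I x y -> x < N.+1 /\ y < N.+1.
Proof. by move=> /boxI; lia. Qed.
Lemma corner_lt x y : corner_pt x y -> x < N.+1 /\ y < N.+1.
Proof. by move=> /or4P[] /cells_lt[]; lia. Qed.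

Definition below (h : nat -> nat -> bool) x y := \big[addb/false]_(j < y) h x j.

Lemma belowS h x y : below h x y.+1 = below h x y (+) h x y.
Proof. by rewrite /below big_ord_recr. Qed.

(* The edge set (h, v) is the boundary of the set of cells having an odd number
   of its edges below them. That set is empty: outside I by co-connectedness,
   inside I by assumption. *)
Lemma cycle_eq0 (h v : nat -> nat -> bool) x0 y0 :
  (forall x y, h x y -> hedge x y) -> (forall x y, v x y -> vedge x y) ->
  (forall x y, (x, y) != (x0, y0) -> h x y (+) h x.+1 y (+) v x y (+) v x y.+1 = false) ->
  (forall x y, I x y -> below h x y = false) ->
  forall x y, h x y = false /\ v x y = false.
Proof.
move=> hh hv even inI.
have h0 y : h 0 y = false.
  by apply/negP => /hh; rewrite /hedge !cells0x.
have hN x y : N <= x -> h x y = false.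
  by move=> le; apply/negP => /hh; rewrite /hedge !cellsNx.
have vN x y : N <= y -> v x y = false.
  by move=> le; apply/negP => /hv; rewrite /vedge !cellsxN.
have v0 x : v x 0 = false by apply/negP => /hv; rewrite /vedge !cellsx0.
(* [D x y] is the defect at the right edge of the cell (x, y): it vanishes when [v] contains this
   edge exactly if the parities of the two cells along it differ. Evenness at a vertex keeps [D]
   unchanged from one row to the next. *)
pose D x y := v x y (+) below h x y (+) below h x.+1 y.
have D0 x : D x 0 = false by rewrite /D v0 /below !big_ord0.
have DS x y : (x, y) != (x0, y0) -> D x y.+1 = D x y.
  move=> /even; rewrite /D !belowS.
  by case: (h x y); case: (h x.+1 y); case: (v x y); case: (v x y.+1);
     case: (below h x y); case: (below h x.+1 y).
have Dne x y : x != x0 -> D x y = false.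
  by move=> ne; elim: y => // y <-; apply: DS; rewrite xpair_eqE (negbTE ne).
have belowN x y : N <= x -> below h x y = false.
  by move=> le; rewrite /below big1 // => j _; apply: hN.
(* In the column of the exceptional vertex this is the fact that a graph never has a single odd
   vertex. On the row [M] above the box, parities are constant from the left end to [x0] and from
   [x0.+1] to the right end, and they vanish at both ends. *)
have DxN x M : N <= M -> D x M = false.
  move=> leM; have [->|/Dne//] := eqVneq x x0.
  have step z : z != x0 -> below h z M = below h z.+1 M.
    by move=> /(Dne _ M); rewrite /D vN // addFb; do 2!case: below.
  have left z : z <= x0 -> below h z M = false.
    elim: z => [|z IH] le.
      by rewrite /below big1.
    by rewrite -step ?IH //; lia.
  have right k z : x0 < z -> below h z M = below h (z + k) M.
    move=> lt; elim: k => [|k ->]; first by rewrite addn0.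
    by rewrite addnS step //; lia.
  by rewrite /D vN // left // (right N x0.+1) // belowN //; lia.
have Dup k x y : y0 < y -> D x y = D x (y + k).
  move=> lt; elim: k => [|k ->]; first by rewrite addn0.
  by rewrite addnS DS // xpair_eqE; lia.
have DD x y : D x y = false.
  have [le|lt] := leqP y y0; last by rewrite (@Dup N) // DxN //; lia.
  elim: y le => // y IH le; rewrite DS ?IH // ?xpair_eqE; lia.
have S0 x y : below h x y = false.
  case: (boolP (I x y)) => [/inI//|].
  apply: (coI (Q := fun x y => below h x y = false)); last by rewrite /below big_ord0.
  split=> {}x {}y n1 n2.
    have vF : v x y = false.
      by apply/negP => /hv; rewrite /vedge (negbTE n1) (negbTE n2).
    by move: (DD x y); rewrite /D vF; do 2!case: below.
  have hF : h x y = false.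
    by apply/negP => /hh; rewrite /hedge (negbTE n1) (negbTE n2).
  by rewrite belowS hF addbF.
move=> x y; split; first by move: (belowS h x y); rewrite !S0; case: (h x y).
by move: (DD x y); rewrite /D !S0; case: (v x y).
Qed.

Let M := N.+1.
Let T := ('I_M * 'I_M)%type.
Let msum (f : nat -> nat -> nat) := \sum_(x < M) \sum_(y < M) f x y.

Let grid_set (f : nat -> nat -> bool) : {set T} := [set p : T | f p.1 p.2].

Lemma card_grid_set f : #|grid_set f| = msum f.
Proof.
rewrite /msum pair_big /= -sum1_card big_mkcond /=.
by apply: eq_bigr => p _; rewrite inE; case: f.
Qed.

Let ind (s : {set T}) x y := [&& x < M, y < M & (inord x, inord y) \in s].

Let indE (s : {set T}) (p : T) : ind s p.1 p.2 = (p \in s).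
Proof. by rewrite /ind !ltn_ord !inord_val -surjective_pairing. Qed.

Let ind_sub (s : {set T}) f x y : s \subset grid_set f -> ind s x y -> f x y.
Proof.
move=> /fintype.subsetP sub /and3P[lx ly /sub]; rewrite inE /= !inordK //.
Qed.

(* An edge set is determined by its odd vertices other than a fixed [v0] and by
   the cells with an odd number of its edges below them, so that
   2 ^ E <= 2 ^ (V - 1 + F). *)
Lemma euler_cells x1 y1 : I x1 y1 ->
  msum hedge + msum vedge < msum corner_pt + msum I.
Proof.
move=> I1; rewrite -!card_grid_set.
pose v0 : T := (inord x1, inord y1).
have [lx1 ly1] := cells_lt I1.
have v0in : v0 \in grid_set corner_pt.
  by rewrite inE /= !inordK // /corner_pt I1.
pose odd_at (s : {set T} * {set T}) x y :=
  ind s.1 x y (+) ind s.1 x.+1 y (+) ind s.2 x y (+) ind s.2 x y.+1.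
pose F (s : {set T} * {set T}) : {set T} * {set T} :=
  ([set p in grid_set corner_pt :\ v0 | odd_at s p.1 p.2],
   [set p in grid_set I | below (ind s.1) p.1 p.2]).
pose A := finset.setX (finset.powerset (grid_set hedge)) (finset.powerset (grid_set vedge)).
pose B := finset.setX (finset.powerset (grid_set corner_pt :\ v0)) (finset.powerset (grid_set I)).
have FAB : F @: A \subset B.
  apply/fintype.subsetP => _ /imsetP[s _ ->].
  by rewrite inE !finset.powersetE /F /=; apply/andP; split; apply/fintype.subsetP => p; rewrite inE => /andP[].
have Finj : {in A &, injective F}.
  move=> [s1 s2] [t1 t2]; rewrite /A !inE /= => /andP[ss1 ss2] /andP[st1 st2].
  case=> Eo Eb.
  (* The symmetric difference of two edge sets with the same image has no odd vertex, except
     possibly [v0], and gives even parity to all cells of [I]: [cycle_eq0] makes it empty. *)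
  pose h x y := ind s1 x y (+) ind t1 x y; pose v x y := ind s2 x y (+) ind t2 x y.
  have hh x y : h x y -> hedge x y.
    rewrite /h; case e: (ind s1 x y); first by move=> _; apply: ind_sub e.
    by move=> e'; apply: ind_sub e'.
  have hv x y : v x y -> vedge x y.
    rewrite /v; case e: (ind s2 x y); first by move=> _; apply: ind_sub e.
    by move=> e'; apply: ind_sub e'.
  have corner_edges x y : ~~ corner_pt x y ->
      [/\ ~~ hedge x y, ~~ hedge x.+1 y, ~~ vedge x y & ~~ vedge x y.+1].
    by rewrite /corner_pt /hedge /vedge; do 4!case: (I _ _).
  have [hF vF] : (forall x y, h x y = false) /\ (forall x y, v x y = false).
    suff H : forall x y, h x y = false /\ v x y = false.
      by split=> x y; case: (H x y).
    apply: (@cycle_eq0 h v x1 y1) => // x y.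
      move=> ne; case: (boolP (corner_pt x y)) => [cxy|/corner_edges[n1 n2 n3 n4]].
        have [lx ly] := corner_lt cxy.
        have := congr1 (fun s : {set T} => (inord x, inord y) \in s) Eo.
        rewrite !inE /= !inordK // cxy !andbT.
        have -> : ((inord x, inord y) != v0) = true.
          apply: contra ne => /eqP[/(congr1 val) /= e1 /(congr1 val) /= e2].
          by move: e1 e2; rewrite !inordK // => -> ->.
        rewrite /odd_at /h /v /=.
        by do 8!case: (ind _ _ _).
      have F1 p q : ~~ hedge p q -> h p q = false.
        by move=> n; apply/negP => /hh; apply/negP.
      have F2 p q : ~~ vedge p q -> v p q = false.
        by move=> n; apply/negP => /hv; apply/negP.
      by rewrite !F1 // !F2.
    move=> Ixy.
    have [lx ly] := cells_lt Ixy.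
    have := congr1 (fun s : {set T} => (inord x, inord y) \in s) Eb.
    rewrite !inE /= !inordK // Ixy /=.
    rewrite /below /h big_split /= => ->; exact: addbb.
  have E (s t : {set T}) : (forall x y, ind s x y (+) ind t x y = false) -> s = t.
    move=> H; apply/setP => p; move: (H p.1 p.2); rewrite !indE.
    by do 2!case: (p \in _).
  by rewrite (E _ _ hF) (E _ _ vF).
have := subset_leq_card FAB; rewrite card_in_imset // !cardsX !card_powerset.
rewrite -!expnD leq_exp2l // => le.
by rewrite (cardsD1 v0 (grid_set corner_pt)) v0in add1n addSn ltnS.
Qed.

Let convex x y := quad x y == 1.
Definition reflex x y := quad x y == 3.

Lemma msum_shiftx (f : nat -> nat -> nat) :
  (forall y, f 0 y = 0) -> (forall y, f M y = 0) ->
  msum (fun x y => f x.+1 y) = msum f.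
Proof.
move=> f0 fM; rewrite /msum.
rewrite [RHS]big_ord_recl [X in _ = X + _]big1 // add0n [LHS]big_ord_recr /=.
by rewrite [X in _ + X]big1 ?addn0 // => y _; rewrite fM.
Qed.

Lemma msum_shifty (f : nat -> nat -> nat) :
  (forall x, f x 0 = 0) -> (forall x, f x M = 0) ->
  msum (fun x y => f x y.+1) = msum f.
Proof.
move=> f0 fM; rewrite /msum; apply: eq_bigr => x _.
by rewrite [RHS]big_ord_recl /= f0 add0n [LHS]big_ord_recr /= fM addn0.
Qed.

(** At each lattice point, [reflex + 4 * corner + cells <= convex + 2 * edges], with equality unless
    two cells meet only at that point. In the sum an edge is counted at its two ends and a cell at
    its four corners, which leaves 4 times [euler_cells]. *)
Lemma reflex_convex x1 y1 : I x1 y1 -> msum reflex + 4 <= msum convex.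
Proof.
move=> I1.
have EL := euler_cells I1.
have hs1 : msum (fun x y => hedge x.+1 y) = msum hedge.
  apply: (@msum_shiftx hedge) => y; first by rewrite /hedge !cells0x.
  by rewrite /hedge !cellsNx.
have vs1 : msum (fun x y => vedge x y.+1) = msum vedge.
  apply: (@msum_shifty vedge) => y; first by rewrite /vedge !cellsx0.
  by rewrite /vedge !cellsxN.
have Is1 : msum (fun x y => I x.+1 y) = msum I.
  by apply: (@msum_shiftx I) => y; rewrite ?cells0x ?cellsNx.
have Is2 : msum (fun x y => I x y.+1) = msum I.
  by apply: (@msum_shifty I) => y; rewrite ?cellsx0 ?cellsxN.
have Is3 : msum (fun x y => I x.+1 y.+1) = msum I.
  rewrite -Is2; apply: (@msum_shiftx (fun x y => I x y.+1)) => y; rewrite ?cells0x ?cellsNx //.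
have add f g : msum f + msum g = msum (fun x y => f x y + g x y).
  by rewrite /msum -big_split; apply: eq_bigr => x _; rewrite -big_split.
have mul k f : k * msum f = msum (fun x y => k * f x y).
  by rewrite /msum big_distrr; apply: eq_bigr => x _; rewrite big_distrr.
have : msum reflex + 4 * msum corner_pt +
       (msum I + msum (fun x y => I x.+1 y) + msum (fun x y => I x y.+1)
         + msum (fun x y => I x.+1 y.+1))
    <= msum convex + 2 * (msum hedge + msum (fun x y => hedge x.+1 y)
         + msum vedge + msum (fun x y => vedge x y.+1)).
  rewrite !add !mul !add; apply: leq_sum => x _; apply: leq_sum => y _.
  rewrite /reflex /convex /quad /corner_pt /hedge /vedge.
  by case: (I x y); case: (I x.+1 y); case: (I x y.+1); case: (I x.+1 y.+1).
by rewrite Is1 Is2 Is3 hs1 vs1; lia.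
Qed.

End Cells.

(** * The even-odd rule for lattice polygons *)

Lemma ordS_transitive n (P : 'I_n -> Prop) :
  (forall i, P i -> P (ordS i)) -> forall i j, P i -> P j.
Proof.
move=> PS i j Pi.
have it k : P (iter k (@ordS n) i) by elim: k => //= k; apply: PS.
have val_it k : iter k (@ordS n) i = (i + k) %% n :> nat.
  elim: k => [|k IH]; first by rewrite addn0 modn_small.
  by rewrite iterS /= IH addnS -addn1 modnDml addn1.
suff <- : iter (n + j - i) (@ordS n) i = j by [].
apply: ord_inj; rewrite val_it.
have := ltn_ord i; have := ltn_ord j => jn in_.
have -> : i + (n + j - i) = j + n by lia.
by rewrite modnDr modn_small.
Qed.

Lemma xor_unique n (F : 'I_n -> bool) : (forall i j, F i -> F j -> i = j) ->
  \big[addb/false]_i F i = [exists i, F i].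
Proof.
move=> uF; have [/existsP[i Fi]|/existsPn nF] := boolP [exists i, F i].
  rewrite (bigD1 i) //= Fi big1 // => j ji; apply/negP => /(uF _ _ Fi) e.
  by rewrite e eqxx in ji.
by rewrite big1 // => i _; apply/negbTE/nF.
Qed.

Lemma chain_iff (P : nat -> Prop) m M :
  (forall x, m <= x < M -> (P x <-> P x.+1)) ->
  forall x x', m <= x <= M -> m <= x' <= M -> P x -> P x'.
Proof.
move=> step.
have from_m k : m + k <= M -> (P m <-> P (m + k)).
  elim: k => [|k IH] le; first by rewrite addn0.
  by rewrite IH ?addnS; [apply: step; lia|lia].
move=> x x' mx mx'; have := from_m (x - m); have := from_m (x' - m).
rewrite !subnKC; try lia.
by move=> [|h _]; [lia|move=> [|_ h' /h' /h]; [lia|]].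
Qed.

Section LatticePolygon.
Variables (n : nat) (a b : 'I_n -> nat).

(** Cell index [x] stands for the strip between the grid lines [x] and [x.+1]. The comparison of the
    two ends detects a passage over this strip in either direction, and is false for a vertical
    side. *)
Definition hspan i x := (a i <= x) (+) (a (ordS i) <= x).
Definition vspan i y := (b i <= y) (+) (b (ordS i) <= y).
Definition on_side i x y :=
  [&& minn (a i) (a (ordS i)) <= x <= maxn (a i) (a (ordS i))
    & minn (b i) (b (ordS i)) <= y <= maxn (b i) (b (ordS i))].

(** Positive coordinates leave row 0 and column 0 free around the polygon. The alternation of
    directions excludes flat vertices, so that parallel sides never touch. *)
Definition lattice_polygon : Prop :=
  [/\ forall i, 0 < a i /\ 0 < b i,
      forall i, (a i == a (ordS i)) = (b i != b (ordS i)),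
      forall i, (a i == a (ordS i)) = (a (ordS i) != a (ordS (ordS i)))
    & forall i j x y, i != j -> on_side i x y -> on_side j x y ->
        (j = ordS i /\ (x, y) = (a j, b j)) \/ (i = ordS j /\ (x, y) = (a i, b i))].

Hypothesis lp : lattice_polygon.

(* The even-odd rule: parity of the number of sides met by the downward ray
   from the cell (x, y). *)
Definition cell x y := \big[addb/false]_i (hspan i x && (b i <= y)).

Lemma hspan_axis i x : hspan i x -> a i != a (ordS i) /\ b i = b (ordS i).
Proof.
case: lp => _ ax _ _; move: (ax i); rewrite /hspan.
by case: eqVneq => [->|_ /esym/negbFE/eqP //]; rewrite addbb.
Qed.

Lemma vspan_axis i y : vspan i y -> a i = a (ordS i) /\ b i != b (ordS i).
Proof.
case: lp => _ ax _ _; move: (ax i); rewrite /vspan.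
by case: (b i =P b (ordS i)) => [->|_ /eqP //]; rewrite addbb.
Qed.

Lemma hspan_on i x : hspan i x -> on_side i x (b i) /\ on_side i x.+1 (b i).
Proof.
by move=> h; have [ne e] := hspan_axis h; move: h; rewrite /hspan /on_side -e; lia.
Qed.

Lemma vspan_on i y : vspan i y -> on_side i (a i) y /\ on_side i (a i) y.+1.
Proof.
by move=> h; have [e ne] := vspan_axis h; move: h; rewrite /vspan /on_side -e; lia.
Qed.

(** Distinct sides with a common point are consecutive, hence perpendicular. *)
Lemma hspan_disjoint i j x x' p q :
  hspan i x -> hspan j x' -> on_side i p q -> on_side j p q -> i = j.
Proof.
move=> hi hj oi oj; apply/eqP/negPn/negP => ne.
case: lp => _ _ turn /(_ _ _ _ _ ne oi oj).
have [ni _] := hspan_axis hi; have [nj _] := hspan_axis hj.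
case=> -[e _]; move: ni nj; rewrite e.
  by have := turn i; lia.
by have := turn j; lia.
Qed.

Lemma vspan_disjoint i j y y' p q :
  vspan i y -> vspan j y' -> on_side i p q -> on_side j p q -> i = j.
Proof.
move=> hi hj oi oj; apply/eqP/negPn/negP => ne.
case: lp => _ _ turn /(_ _ _ _ _ ne oi oj).
have [ni _] := vspan_axis hi; have [nj _] := vspan_axis hj.
case=> -[e _]; move: ni nj; rewrite e.
  by have := turn i; lia.
by have := turn j; lia.
Qed.

Lemma cell_flip_up x y :
  cell x y.+1 (+) cell x y = [exists i, hspan i x && (b i == y.+1)].
Proof.
rewrite /cell -big_split /= -xor_unique; last first.
  move=> i j /andP[hi /eqP bi] /andP[hj /eqP bj].
  have [oi _] := hspan_on hi; have [oj _] := hspan_on hj.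
  by rewrite bi in oi; rewrite bj in oj; apply: hspan_disjoint hi hj oi oj.
by apply: eq_bigr => i _; rewrite -andb_addr; congr andb; lia.
Qed.

Lemma cell_flip_right x y :
  cell x.+1 y (+) cell x y = [exists i, vspan i y && (a i == x.+1)].
Proof.
rewrite /cell -big_split /= -xor_unique; last first.
  move=> i j /andP[hi /eqP ai] /andP[hj /eqP aj].
  have [oi _] := vspan_on hi; have [oj _] := vspan_on hj.
  by rewrite ai in oi; rewrite aj in oj; apply: vspan_disjoint hi hj oi oj.
transitivity (\big[addb/false]_i ((a i == x.+1) && (b i <= y)) (+)
              \big[addb/false]_i ((a (ordS i) == x.+1) && (b i <= y))).
  rewrite -big_split; apply: eq_bigr => i _ /=; rewrite /hspan.
  by case: (b i <= y); rewrite ?andbF // !andbT; lia.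
(* After this shift both terms concern the end [ordS i] of side [i], tested at the heights of the
   two ends of that side. They differ only if the side is vertical and crosses row [y]. *)
rewrite (reindex_inj (@ordS_inj n)) -big_split; apply: eq_bigr => i _ /=.
have := @vspan_axis i y; rewrite /vspan.
by case: (b i <= y); case: (b (ordS i) <= y); rewrite ?andbF ?andbT ?addbb //=;
  rewrite ?addbF => -[//|-> _].
Qed.

Definition lattice_bound := (\max_i maxn (a i) (b i)).+1.

Lemma lattice_bound_gt i : a i < lattice_bound /\ b i < lattice_bound.
Proof.
have := @leq_bigmax 'I_n (fun i => maxn (a i) (b i)) i.
by rewrite geq_max => /andP[].
Qed.

Lemma cell_in_box : cells_in_box lattice_bound cell.
Proof.
case: lp => pos _ _ _ x y.
have c0 (F : 'I_n -> bool) : F =1 (fun=> false) -> \big[addb/false]_i F i = false.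
  by move=> F0; rewrite big1.
move=> cxy; apply/and4P; split; rewrite ltnNge; apply/negP => le; move: cxy; apply/negP/negPf.
- by apply: c0 => i; rewrite /hspan; have [] := pos i; have [] := pos (ordS i); lia.
- by apply: c0 => i; have [] := pos i; lia.
- by apply: c0 => i; rewrite /hspan; have [] := lattice_bound_gt i;
    have [] := lattice_bound_gt (ordS i); lia.
(* Above the bound all sides over the column are counted, and a closed curve passes over a column an
   even number of times. *)
- transitivity (\big[addb/false]_i hspan i x).
    by apply: eq_bigr => i _; have [_ h] := lattice_bound_gt i; rewrite (leq_trans _ le) ?andbT // ltnW.
  rewrite /hspan big_split /= (reindex_inj (@ordS_inj n)) /=; exact: addbb.
Qed.

(* No vertex is a pinch point: three boundary edges never meet. *)
Lemma cell_no_pinch x y :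
  cell x y = cell x.+1 y.+1 -> cell x.+1 y = cell x y.+1 -> cell x y = cell x.+1 y.
Proof.
move=> e1 e2; apply/eqP/negPn/negP => ne.
have /existsP[i /andP[hi /eqP bi]] : [exists i, hspan i x.+1 && (b i == y.+1)].
  by rewrite -cell_flip_up; move: ne; rewrite e1; do 2!case: (cell _ _).
have /existsP[j /andP[hj /eqP bj]] : [exists i, hspan i x && (b i == y.+1)].
  by rewrite -cell_flip_up -e2; move: ne; do 2!case: (cell _ _).
have /existsP[k /andP[vk /eqP ak]] : [exists i, vspan i y.+1 && (a i == x.+1)].
  by rewrite -cell_flip_right -e1 -e2; move: ne; do 2!case: (cell _ _).
have [oi _] := hspan_on hi; have [_ oj] := hspan_on hj; have [ok _] := vspan_on vk.
rewrite bi in oi; rewrite bj in oj; rewrite ak in ok.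
(* The two horizontal edges lie on one side, which has the point in its relative interior. The
   vertical side [k] through this point then contradicts simplicity. *)
have eij := hspan_disjoint hi hj oi oj; subst j.
have [na _] := hspan_axis hi; have [eak _] := vspan_axis vk.
have nik : i != k by apply: contraNneq na => ->; rewrite eak.
move: hi hj; rewrite /hspan.
by case: lp => _ _ _ /(_ _ _ _ _ nik oi ok) [] [e [e3 _]]; move: e3; rewrite -?eak ?e ?ak; lia.
Qed.

(** The parity of the four cells is a sum over the sides, to which a side contributes only if it
    ends at the common corner. *)
Lemma cell_odd_corner x y : odd (quad cell x y) ->
  exists i, a i = x.+1 /\ b i = y.+1.
Proof.
suff : odd (quad cell x y) -> [exists i, (a i == x.+1) && (b i == y.+1)].
  by move=> h /h /existsP[i /andP[/eqP ? /eqP ?]]; exists i.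
apply: contraTT => /existsPn nc; apply/negPf.
have -> : odd (quad cell x y) =
    (cell x y.+1 (+) cell x y) (+) (cell x.+1 y.+1 (+) cell x.+1 y).
  by rewrite /quad; do 4!case: (cell _ _).
rewrite /cell -!big_split big1 //= => i _.
have := nc i; have := nc (ordS i); rewrite /hspan.
by case: lp => _ /(_ i); lia.
Qed.

End LatticePolygon.

(** * Connectedness of the inside ([beta] true) and of the outside ([beta] false) *)

Section LatticeConnectivity.
Variables (n : nat) (a b : 'I_n -> nat).
Hypothesis lp : lattice_polygon a b.
Let I := cell a b.
Let apos i : 0 < a i := (let: And4 p _ _ _ := lp in (p i).1).
Let bpos i : 0 < b i := (let: And4 p _ _ _ := lp in (p i).2).

Section Invariant.
Variables (beta : bool) (Q : nat -> nat -> Prop).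
Hypothesis Qinv : adjacency_invariant (fun x y => I x y == beta) Q.

(* [Q] holds around the upper right vertex of the cell (x, y). *)
Let W x y := forall dx dy : bool, I (dx + x) (dy + y) == beta -> Q (dx + x) (dy + y).

(** Without a pinch point, the cells of class [beta] around a vertex are linked through adjacent
    ones, so [Q] spreads from one of them to all. *)
Let vertexW x y (dx dy : bool) :
  I (dx + x) (dy + y) == beta -> Q (dx + x) (dy + y) -> W x y.
Proof.
case: Qinv => Qx Qy.
have := Qx x y; have := Qx x y.+1; have := Qy x y; have := Qy x.+1 y.
have := @cell_no_pinch n a b lp x y.
rewrite -/I /W.
case: dx; case: dy; rewrite ?add1n ?add0n => np q1 q2 q3 q4 s Qs [] [];
  rewrite ?add1n ?add0n => t; move: np q1 q2 q3 q4 s Qs t;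
  case: (I x y); case: (I x.+1 y); case: (I x y.+1); case: (I x.+1 y.+1);
  case: (beta) => np; try (by have := np erefl erefl); tauto.
Qed.

Let edgeW x y x' y' (dx dy ex ey : bool) : dx + x = ex + x' -> dy + y = ey + y' ->
  I (dx + x) (dy + y) == beta -> (W x y <-> W x' y').
Proof.
move=> e1 e2 Ib; split=> h.
  by apply: (@vertexW x' y' ex ey); rewrite -e1 -e2 //; apply: h.
by apply: (@vertexW x y dx dy) => //; rewrite e1 e2; apply: h; rewrite -e1 -e2.
Qed.

(** Each unit edge of a side has an inside cell and an outside one along it. The one of class [beta]
    touches both ends of the edge and carries [W] from one to the other. Predecessors appear because
    a lattice point is indexed by its lower left cell. *)
Let sideW i p q : on_side a b i p q -> W (a i).-1 (b i).-1 <-> W p.-1 q.-1.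
Proof.
have [_ ax _ _] := lp.
have := apos i; have := bpos i; have := apos (ordS i); have := bpos (ordS i).
rewrite /on_side => b'p a'p bp ap.
have := ax i; case: (a i =P a (ordS i)) => [e|ne] /esym.
  move=> nb; rewrite -e => /andP[hp hq].
  have {hp}-> : p = a i by lia.
  have step y : (minn (b i) (b (ordS i))).-1 <= y < (maxn (b i) (b (ordS i))).-1 ->
      W (a i).-1 y <-> W (a i).-1 y.+1.
    move=> hy.
    have : I (a i).-1.+1 y.+1 (+) I (a i).-1 y.+1.
      rewrite cell_flip_right //; apply/existsP; exists i; rewrite /vspan prednK // eqxx; lia.
    have [e0|e1] := eqVneq (I (a i).-1 y.+1) beta => h.
      by apply: (@edgeW _ _ _ _ false true false false) => //; rewrite add0n add1n e0.
    apply: (@edgeW _ _ _ _ true true true false) => //; rewrite !add1n.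
    by move: h e1; case: (I _ _); case: (I _ _); case: (beta).
  by split; apply: (chain_iff step); lia.
move=> /negbFE/eqP eb; rewrite -eb => /andP[hp hq].
have {hq}-> : q = b i by lia.
have step x : (minn (a i) (a (ordS i))).-1 <= x < (maxn (a i) (a (ordS i))).-1 ->
    W x (b i).-1 <-> W x.+1 (b i).-1.
  move=> hx.
  have : I x.+1 (b i).-1.+1 (+) I x.+1 (b i).-1.
    rewrite cell_flip_up //; apply/existsP; exists i; rewrite /hspan prednK // eqxx; lia.
  have [e0|e1] := eqVneq (I x.+1 (b i).-1) beta => h.
    by apply: (@edgeW _ _ _ _ true false false false) => //; rewrite add0n add1n e0.
  apply: (@edgeW _ _ _ _ true true false true) => //; rewrite !add1n.
  by move: h e1; case: (I _ _); case: (I _ _); case: (beta).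
by split; apply: (chain_iff (P := fun x => W x (b i).-1) step); lia.
Qed.

Let allW i j : W (a i).-1 (b i).-1 -> W (a j).-1 (b j).-1.
Proof.
apply: (ordS_transitive (P := fun i => W (a i).-1 (b i).-1)) => {}i.
by move=> /(sideW (p := a (ordS i)) (q := b (ordS i))); apply; rewrite /on_side; lia.
Qed.

(** A walk to the left within class [beta] ends either in column 0 or at a boundary edge, from which
    [sideW] leads to a vertex. *)
Let cellW x y : I x y == beta ->
  (Q x y <-> Q 0 y) /\ (I 0 y == beta) \/ exists i, (Q x y <-> W (a i).-1 (b i).-1).
Proof.
elim: x => [|x IH] Ib; first by left.
have [e0|ne] := eqVneq (I x y) beta.
  have [[h0 h1]|[i hi]] := IH (introT eqP e0).
    by left; split=> //; rewrite -h0; apply: iff_sym; apply: Qinv.1; rewrite ?e0.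
  by right; exists i; rewrite -hi; apply: iff_sym; apply: Qinv.1; rewrite ?e0.
right; have : I x.+1 y (+) I x y.
  by move: Ib ne; case: (I _ _); case: (I _ _); case: (beta).
rewrite cell_flip_right // => /existsP[i /andP[vi /eqP ai]]; exists i.
have [oi _] := vspan_on lp vi; rewrite ai in oi.
have y0 : 0 < y by move: oi; rewrite /on_side; have := bpos i; have := bpos (ordS i); lia.
rewrite (sideW oi) /=; split=> [q|].
  by apply: (@vertexW x y.-1 true true); rewrite !add1n prednK.
by move=> /(_ true true); rewrite !add1n prednK //; apply.
Qed.

(** Column 0 and the cells to the left of a leftmost vertex are outside, which joins (0, 0) to that
    vertex; [allW] reaches the others. *)
Lemma cell_class_connected : ~~ beta -> forall i, Q 0 0 <-> W (a i).-1 (b i).-1.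
Proof.
move=> nb.
have Iaxis x y : (forall j, x < a j) -> I x y == beta.
  move=> lt; rewrite (negbTE nb) /I /cell big1 // => j _; rewrite /hspan.
  by have := lt j; have := lt (ordS j); lia.
move=> i0; have [i _ imin] := @arg_minnP _ i0 predT a isT.
have lt j : (a i).-1 < a j by have := imin j isT; have := apos i; lia.
have c00 y : Q 0 0 <-> Q 0 y.
  elim: y => [//|y ->]; apply: Qinv.2; apply: Iaxis; exact: apos.
have cx x y : x < a i -> Q 0 y <-> Q x y.
  elim: x => [//|x IH] ltx; rewrite IH; last lia.
  by apply: Qinv.1; apply: Iaxis => j; have := imin j isT; lia.
rewrite (c00 (b i).-1) (cx (a i).-1); last by have := apos i; lia.
split=> [q|w].
  by apply: (@allW i); apply: (@vertexW _ _ false false); rewrite !add0n //; apply: Iaxis.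
by have := @allW i0 i w => /(_ false false); rewrite !add0n; apply; apply: Iaxis.
Qed.

(** Inside cells never reach column 0, hence are all tied to the boundary. Outside cells may reach
    it, and then [Q 0 0] takes over. *)
Lemma cell_class_transfer x y x' y' : I x y == beta -> I x' y' == beta ->
  (beta \/ Q 0 0) -> Q x y -> Q x' y'.
Proof.
have I0 z : I 0 z = false by exact: (cells0x (cell_in_box lp)).
move=> /cellW c /cellW c' h q.
case: (boolP beta) => bb.
  case: c => [[_ /eqP]|[i ci]]; first by rewrite I0 bb.
  case: c' => [[_ /eqP]|[j cj]]; first by rewrite I0 bb.
  by apply/cj; apply: (@allW i); apply/ci.
have q0 : Q 0 0 by case: h => //; rewrite (negbTE bb).
have q0y z : Q 0 z.
  by elim: z => // z IH; apply/(Qinv.2 0 z); rewrite ?I0 // (negbTE bb).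
case: c' => [[e _]|[j cj]]; first by apply/e.
by apply/cj/cell_class_connected.
Qed.
End Invariant.

Lemma cell_connected Q : adjacency_invariant I Q ->
  forall x y x' y', I x y -> I x' y' -> Q x y -> Q x' y'.
Proof.
move=> [Qx Qy] x y x' y' Ixy Ixy'.
apply: (@cell_class_transfer true); rewrite ?Ixy ?Ixy' //; last by left.
by split=> {Ixy Ixy'}x {}y /eqP h /eqP h'; [apply: Qx|apply: Qy].
Qed.

Lemma cell_co_connected : co_connected I.
Proof.
have I0 z : I 0 z = false by exact: (cells0x (cell_in_box lp)).
move=> Q [Qx Qy] q0 x y nI.
apply: (@cell_class_transfer false Q _ 0 0 x y); rewrite ?I0 ?(negbTE nI) //; last by right.
by split=> {nI}x {}y h h'; [apply: Qx|apply: Qy]; rewrite -eqbF_neg.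
Qed.

Lemma cell_exists (i0 : 'I_n) : exists x y, I x y.
Proof.
have [_ ax turn _] := lp.
have [i hi] : exists i, a i != a (ordS i).
  have [e|] := eqVneq (a i0) (a (ordS i0)); last by exists i0.
  by exists (ordS i0); move: (turn i0); rewrite e eqxx.
have [hs bi] : hspan a i (minn (a i) (a (ordS i))) /\ b i = b (ordS i).
  by move: (ax i) hi; rewrite /hspan; lia.
have : I (minn (a i) (a (ordS i))) (b i).-1.+1 (+) I (minn (a i) (a (ordS i))) (b i).-1.
  by rewrite cell_flip_up //; apply/existsP; exists i; rewrite hs prednK ?eqxx.
by case e: (I _ _); [move=> _; do 2!eexists; exact: e|move=> ?; do 2!eexists; eassumption].
Qed.

(* The convex vertices exceed the reflex ones by at least four, and all of them
   are among the [n] given points. *)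
Lemma reflex_count (i0 : 'I_n) (N := (lattice_bound a b).+1) :
  2 * (\sum_(x < N) \sum_(y < N) reflex I x y) + 4 <= n.
Proof.
have [x1 [y1 I1]] := cell_exists i0.
have := reflex_convex (cell_in_box lp) cell_co_connected I1; rewrite -/N -/I.
set r := (X in X + 4 <= _); set c := (X in _ <= X) => le.
suff : r + c <= n by rewrite -/r; lia.
rewrite /r /c -big_split /=.
under eq_bigr do rewrite -big_split.
rewrite pair_big /=.
pose corner (i : 'I_n) : 'I_N * 'I_N := (inord (a i).-1, inord (b i).-1).
rewrite -[leqRHS]card_ord -(cardsT 'I_n).
apply: leq_trans (leq_imset_card corner [set: 'I_n]).
rewrite -sum1_card [leqRHS]big_mkcond; apply: leq_sum => -[x y] _ /=.
have : odd (quad I x y) -> (x, y) \in corner @: [set: 'I_n].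
  move=> /(cell_odd_corner lp)[i [ai bi]]; apply/imsetP; exists i => //.
  by rewrite /corner ai bi /= !inord_val.
by rewrite /reflex; case: (_ \in _) => h; case: (quad I x y) h => [|[|[|[|m]]]] //= /(_ isT).
Qed.

End LatticeConnectivity.

(** * Guards on vertical chords *)

Lemma maximal_interval (P : nat -> bool) N y :
  P 0 = false -> (forall z, N <= z -> P z = false) -> P y ->
  exists l h, [/\ l <= y < h, forall z, l <= z < h -> P z, ~~ P l.-1 & ~~ P h].
Proof.
move=> P0 PN Py.
have down : exists l, [/\ l <= y, forall z, l <= z <= y -> P z & ~~ P l.-1].
  elim: y Py => [|y IH] Py; first by rewrite P0 in Py.
  case e: (P y); last first.
    exists y.+1; split=> [//|z hz|]; last by rewrite /= e.
    by have -> : z = y.+1 by lia.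
  have [l [ly hl nl]] := IH e; exists l; split=> // [|z hz]; first lia.
  have [ze|ne] := eqVneq z y.+1; first by rewrite ze.
  by apply: hl; lia.
have up : exists h, [/\ y < h, forall z, y <= z < h -> P z & ~~ P h].
  have : exists h, (y < h) && ~~ P h by exists (maxn N y.+1); rewrite PN; lia.
  move=> /ex_minnP[h /andP[yh nh] hmin]; exists h; split=> // z hz.
  apply/negPn/negP => nz; have [ze|ne] := eqVneq z y; first by rewrite ze Py in nz.
  by have := hmin z; rewrite nz; lia.
have [l [ly hl nl]] := down; have [h [yh hh nh]] := up.
exists l, h; split=> // [|z hz]; first lia.
by have [le|lt] := leqP z y; [apply: hl|apply: hh]; lia.
Qed.

Lemma seq_of_functional_rel (T U : eqType) (rel : T -> U -> Prop) (t : seq T) :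
  (forall p, p \in t -> exists g, rel p g /\ forall g', rel p g' -> g' = g) ->
  exists s : seq U, size s = size t /\
    forall g, g \in s <-> exists p, p \in t /\ rel p g.
Proof.
elim: t => [|p t IH] fr; first by exists [::]; split=> // g; split=> // -[? []].
have [s [ss hs]] : exists s : seq U, size s = size t /\
    forall g, g \in s <-> exists p, p \in t /\ rel p g.
  by apply: IH => q qt; apply: fr; rewrite inE qt orbT.
have [g [pg ug]] := fr p (mem_head _ _).
exists (g :: s); split=> [|g']; first by rewrite /= ss.
rewrite inE; split=> [/orP[/eqP->|/hs[q [qt qg]]]|[q []]].
- by exists p; rewrite mem_head.
- by exists q; rewrite inE qt orbT.
rewrite inE => /orP[/eqP-> /ug->|qt qg]; first by rewrite eqxx.
by apply/orP; right; apply/hs; exists q.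
Qed.

(* A guard [(k, h, up)] stands at the lattice point (k, h) and looks at the
   upper half-plane if [up], at the lower one otherwise. *)
Definition lguard : Type := (nat * nat * bool)%type.

Definition faces (g : lguard) t := if g.2 then g.1.2 <= t else t <= g.1.2.

Section Guards.
Variables (N : nat) (I : nat -> nat -> bool).
Hypothesis boxI : cells_in_box N I.

Definition run i b a :=
  [/\ b < a, forall j, b <= j < a -> I i j, ~~ I i b.-1 & ~~ I i a].

(** All columns share one maximal vertical interval, so the rectangle is saturated in height; it may
    still grow sideways, by [rect_union]. *)
Definition rect i1 i2 b a := i1 <= i2 /\ forall i, i1 <= i <= i2 -> run i b a.

Definition stands_in (g : lguard) i1 i2 b a :=
  (i1 <= g.1.1 <= i2.+1) && (b <= g.1.2 <= a).

(** A sufficient condition for mutual visibility: the common rectangle is convex, so it contains the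
    segment between the guards. *)
Definition lsees (g g' : lguard) := exists i1 i2 b a,
  [/\ rect i1 i2 b a, stands_in g i1 i2 b a, stands_in g' i1 i2 b a,
      faces g g'.1.2 & faces g' g.1.2].

Definition covers (g : lguard) x y := exists i1 i2 b a,
  [/\ rect i1 i2 b a, stands_in g i1 i2 b a, i1 <= x <= i2, b <= y < a
    & faces g y && faces g y.+1].

Definition lconnected (s : seq lguard) :=
  {in s &, forall g g', clos_refl_trans lguard
     (fun g1 g2 => [/\ g1 \in s, g2 \in s & lsees g1 g2]) g g'}.

Lemma run_unique i b a b' a' j :
  run i b a -> run i b' a' -> b <= j < a -> b' <= j < a' -> b = b' /\ a = a'.
Proof.
move=> [lt hI nb na] [lt' hI' nb' na'] hj hj'; split; apply/eqP/negPn/negP => ne.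
  have [l|g] := ltnP b b'.
    by move: nb'; rewrite hI //; lia.
  by move: nb; rewrite hI' //; lia.
have [l|g] := ltnP a a'.
  by move: na; rewrite hI' //; lia.
by move: na'; rewrite hI //; lia.
Qed.

Lemma rect_union i1 i2 b a i1' i2' b' a' i j :
  rect i1 i2 b a -> rect i1' i2' b' a' ->
  i1 <= i <= i2 -> b <= j < a -> i1' <= i <= i2' -> b' <= j < a' ->
  [/\ b' = b, a' = a & rect (minn i1 i1') (maxn i2 i2') b a].
Proof.
move=> [le r] [le' r'] hi hj hi' hj'.
have [eb ea] := run_unique (r i hi) (r' i hi') hj hj'; subst b' a'.
split=> //; split=> [|k hk]; first lia.
have [kk|nk] := boolP (i1 <= k <= i2); first exact: r.
by apply: r'; lia.
Qed.

Lemma run_exists i j : I i j -> exists b a, run i b a /\ b <= j < a.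
Proof.
move=> Iij.
have [||b [a [hj hI nb na]]] := @maximal_interval (I i) N j _ _ Iij.
- exact: cellsx0 boxI i.
- by move=> z; apply: cellsxN boxI i z.
by exists b, a; split=> //; split=> //; lia.
Qed.

Lemma run_max i b a l h j : run i b a -> (forall z, l <= z < h -> I i z) ->
  l <= j < h -> b <= j < a -> b <= l /\ h <= a.
Proof.
move=> [lt hI nb na] hz hj hj'.
have b0 : 0 < b.
  by case: b lt hI nb na hj' => // lt /(_ 0); rewrite (cellsx0 boxI) => ->.
split; rewrite leqNgt; apply/negP => le.
  by move: nb; rewrite hz //; lia.
by move: na; rewrite hz //; lia.
Qed.

(* A maximal open vertical segment on the line between the columns [x] and
   [x.+1], covering the rows [l, ..., h - 1]. *)
Definition gap x l h := [/\ l < h, forall y, l <= y < h -> I x y && I x.+1 y,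
  ~~ (I x l.-1 && I x.+1 l.-1) & ~~ (I x h && I x.+1 h)].

(** At the lower end of a gap the two cells below are not both inside, so the disjunction means
    exactly one: the end is a reflex point. *)
Definition low_notch x l := I x l.-1 || I x.+1 l.-1.
Definition high_notch x h := I x h || I x.+1 h.

Definition guards_gap x l h (g : lguard) := gap x l h /\
  (low_notch x l /\ g = (x.+1, h, false) \/ high_notch x h /\ g = (x.+1, l, true)).

Lemma gap_exists x y : I x y -> I x.+1 y -> exists l h, gap x l h /\ l <= y < h.
Proof.
move=> I1 I2.
have [|||l [h [hy hI nl nh]]] := @maximal_interval (fun y => I x y && I x.+1 y) N y.
- by rewrite (cellsx0 boxI).
- by move=> z zN; rewrite (cellsxN boxI).
- by rewrite I1.
by exists l, h; split=> //; split=> //; lia.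
Qed.

Lemma gap_low_pos x l h : gap x l h -> 0 < l.
Proof.
by case=> lt op _ _; case: l lt op => // lt /(_ 0); rewrite lt (cellsx0 boxI) => /(_ isT).
Qed.

(** Without notches the cells beyond both ends are all outside. Such a gap is no border between
    rectangles: its two columns merge. *)
Lemma gap_flat x l h : gap x l h -> ~~ low_notch x l -> ~~ high_notch x h ->
  run x l h /\ run x.+1 l h.
Proof.
move=> [lt op _ _]; rewrite /low_notch /high_notch !negb_or => /andP[n1 n2] /andP[n3 n4].
by split; split=> // j /op /andP[].
Qed.

Lemma gap_high_unique x l h h' : gap x l h -> gap x l h' -> h = h'.
Proof.
move=> [lt op _ nh] [lt' op' _ nh']; apply/eqP/negPn/negP => ne.
have [lth|lth] := ltnP h h'.
  by move: nh; rewrite op' //; lia.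
by move: nh'; rewrite op //; lia.
Qed.

Lemma gap_low_unique x l l' h : gap x l h -> gap x l' h -> l = l'.
Proof.
move=> g g'; have l0 := gap_low_pos g; have l0' := gap_low_pos g'.
case: g g' => lt op nl _ [lt' op' nl' _]; apply/eqP/negPn/negP => ne.
have [ltl|ltl] := ltnP l l'.
  by move: nl'; rewrite op //; lia.
by move: nl; rewrite op' //; lia.
Qed.

Section Attached.
Variables (s : seq lguard).
Hypothesis sP : forall g, g \in s <-> exists x l h, guards_gap x l h g.

Let con := clos_refl_trans lguard (fun g1 g2 => [/\ g1 \in s, g2 \in s & lsees g1 g2]).

Let con_sym g g' : con g g' -> con g' g.
Proof.
elim=> [g1 g2 [h1 h2 [i1 [i2 [b [a [r p1 p2 f1 f2]]]]]]|g1|g1 g2 g3 _ c1 _ c2].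
- by apply: rt_step; split=> //; exists i1, i2, b, a.
- exact: rt_refl.
- exact: rt_trans c2 c1.
Qed.

(** The gap lies on the grid line [x.+1], which may be a vertical side of the rectangle or cross
    it. *)
Definition gap_touches x l h i1 i2 b a := [&& i1 <= x.+1 <= i2.+1, b <= l & h <= a].

(** A column along the gap belongs to the rectangle, and its run continues beyond an end of the gap
    lying strictly between the heights [b] and [a]. *)
Lemma gap_notch x l h i1 i2 b a : gap x l h -> rect i1 i2 b a ->
  gap_touches x l h i1 i2 b a ->
  (b < l -> low_notch x l) /\ (h < a -> high_notch x h).
Proof.
move=> [lt op _ _] [le r] /and3P[hx hl hh].
have [k [hk ik]] : exists k, (k = x \/ k = x.+1) /\ i1 <= k <= i2.
  by have [l2|l2] := leqP x.+1 i2; [exists x.+1|exists x]; split; auto; lia.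
have [_ rI _ _] := r k ik.
split=> [bl|ha]; rewrite /low_notch /high_notch.
  by have : I k l.-1 by [apply: rI; lia]; case: hk => -> ->; rewrite ?orbT.
by have : I k h by [apply: rI; lia]; case: hk => -> ->; rewrite ?orbT.
Qed.

(** For [l' <= h] the guards face each other. Otherwise [h] and [l'] lie strictly between [b] and
    [a], so both are notches and each chord carries two guards: the link goes from [h] to [l], then
    to [h'], then to [l']. *)
Let rect_down_up x l h x' l' h' i1 i2 b a :
  rect i1 i2 b a -> gap x l h -> gap x' l' h' ->
  gap_touches x l h i1 i2 b a -> gap_touches x' l' h' i1 i2 b a ->
  low_notch x l -> high_notch x' h' -> con (x.+1, h, false) (x'.+1, l', true).
Proof.
move=> r g g' t t' nl nh.
have [lt _ _ _] := g; have [lt' _ _ _] := g'.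
have down x1 l1 h1 : gap x1 l1 h1 -> low_notch x1 l1 -> (x1.+1, h1, false) \in s.
  by move=> ? ?; apply/sP; exists x1, l1, h1; split=> //; left.
have up x1 l1 h1 : gap x1 l1 h1 -> high_notch x1 h1 -> (x1.+1, l1, true) \in s.
  by move=> ? ?; apply/sP; exists x1, l1, h1; split=> //; right.
have direct x1 l1 h1 x2 l2 h2 : gap x1 l1 h1 -> gap x2 l2 h2 ->
  gap_touches x1 l1 h1 i1 i2 b a -> gap_touches x2 l2 h2 i1 i2 b a ->
  low_notch x1 l1 -> high_notch x2 h2 -> l2 <= h1 -> con (x1.+1, h1, false) (x2.+1, l2, true).
  move=> g1 g2 t1 t2 n1 n2 le; apply: rt_step; split; [exact: down g1 n1|exact: up g2 n2|].
  have [lt1 _ _ _] := g1; have [lt2 _ _ _] := g2.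
  exists i1, i2, b, a; move: t1 t2; rewrite /gap_touches /stands_in /faces /=.
  by move=> /and3P[? ? ?] /and3P[? ? ?]; split=> //; lia.
have [le|gt] := leqP l' h; first exact: direct g g' t t' nl nh le.
have /and3P[tx tl th] := t; have /and3P[tx' tl' th'] := t'.
have nh1 : high_notch x h by have [_] := gap_notch g r t; apply; lia.
have nl2 : low_notch x' l' by have [+ _] := gap_notch g' r t'; apply; lia.
have c1 := direct _ _ _ _ _ _ g g t t nl nh1 (ltnW lt).
have lh : l <= h' by lia.
have c2 := direct _ _ _ _ _ _ g' g t' t nl2 nh1 lh.
have c3 := direct _ _ _ _ _ _ g' g' t' t' nl2 nh (ltnW lt').
by apply: rt_trans c3; apply: rt_trans c1 _; apply: con_sym.
Qed.

(** Guards of equal direction and height see each other along their boundary line. Otherwise the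
    lower of two downward guards is below the top of the rectangle, so its chord also carries an
    upward guard, to which both are linked; upward guards are symmetric. *)
Lemma rect_con x l h g x' l' h' g' i1 i2 b a :
  rect i1 i2 b a -> guards_gap x l h g -> guards_gap x' l' h' g' ->
  gap_touches x l h i1 i2 b a -> gap_touches x' l' h' i1 i2 b a -> con g g'.
Proof.
move=> r [G1 D1] [G2 D2] t t'.
have [lt _ _ _] := G1; have [lt' _ _ _] := G2.
have /and3P[tx tl th] := t; have /and3P[tx' tl' th'] := t'.
have [nb1 na1] := gap_notch G1 r t; have [nb2 na2] := gap_notch G2 r t'.
have same g1 g2 : g1 \in s -> g2 \in s ->
    stands_in g1 i1 i2 b a -> stands_in g2 i1 i2 b a -> g1.1.2 = g2.1.2 -> con g1 g2.
  move=> s1 s2 p1 p2 e; apply: rt_step; split=> //; exists i1, i2, b, a; split=> //.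
    by rewrite /faces e leqnn if_same.
  by rewrite /faces e leqnn if_same.
have gs : g \in s by apply/sP; exists x, l, h.
have gs' : g' \in s by apply/sP; exists x', l', h'.
case: D1 gs => -[n1 ->] gs; case: D2 gs' => -[n2 ->] gs'.
- have [e|ne] := eqVneq h h'; first by apply: same => //; rewrite /stands_in /=; lia.
  have [lth|lth] := ltnP h h'.
    apply: rt_trans (rect_down_up r G1 G1 t t n1 _) _; first by apply: na1; lia.
    by apply: con_sym; apply: (rect_down_up r G2 G1 t' t n2 _); apply: na1; lia.
  apply: rt_trans (rect_down_up r G1 G2 t t' n1 _) _; first by apply: na2; lia.
  by apply: con_sym; apply: (rect_down_up r G2 G2 t' t' n2 _); apply: na2; lia.
- exact: rect_down_up r G1 G2 t t' n1 n2.
- by apply: con_sym; apply: (rect_down_up r G2 G1 t' t n2 n1).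
- have [e|ne] := eqVneq l l'; first by apply: same => //; rewrite /stands_in /=; lia.
  have [ltl|ltl] := ltnP l l'.
    apply: rt_trans (con_sym (rect_down_up r G2 G1 t' t _ n1)) _; first by apply: nb2; lia.
    by apply: (rect_down_up r G2 G2 t' t' _ n2); apply: nb2; lia.
  apply: rt_trans (con_sym (rect_down_up r G1 G1 t t _ n1)) _; first by apply: nb1; lia.
  by apply: (rect_down_up r G1 G2 t t' _ n2); apply: nb1; lia.
Qed.

Definition attached i j x l h := exists i1 i2 b a,
  [/\ rect i1 i2 b a, i1 <= i <= i2, b <= j < a & gap_touches x l h i1 i2 b a].

Lemma attached_con i j x l h g x' l' h' g' :
  attached i j x l h -> attached i j x' l' h' ->
  guards_gap x l h g -> guards_gap x' l' h' g' -> con g g'.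
Proof.
move=> [i1 [i2 [b [a [r hi hj t]]]]] [i1' [i2' [b' [a' [r' hi' hj' t']]]]] G G'.
have [eb ea ru] := rect_union r r' hi hj hi' hj'; subst b' a'.
by apply: (rect_con ru G G'); move: t t'; rewrite /gap_touches; lia.
Qed.

Lemma attached_gap x l h j : gap x l h -> l <= j < h ->
  attached x j x l h /\ attached x.+1 j x l h.
Proof.
move=> [lt op _ _] hj.
have /andP[I1 I2] := op j hj; split.
  have [b [a [r hb]]] := run_exists I1.
  have [|bl ha] := run_max r _ hj hb; first by move=> z /op /andP[].
  exists x, x, b, a; split=> //; rewrite /gap_touches; try lia.
  by split=> // i hi; have -> : i = x by lia.
have [b [a [r hb]]] := run_exists I2.
have [|bl ha] := run_max r _ hj hb; first by move=> z /op /andP[].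
exists x.+1, x.+1, b, a; split=> //; rewrite /gap_touches; try lia.
by split=> // i hi; have -> : i = x.+1 by lia.
Qed.

Lemma rect_flat_extend x y l h i1 i2 b a : gap x l h -> l <= y < h ->
  ~~ low_notch x l -> ~~ high_notch x h -> rect i1 i2 b a ->
  i1 <= x <= i2 \/ i1 <= x.+1 <= i2 -> b <= y < a ->
  [/\ b = l, a = h & rect (minn i1 x) (maxn i2 x.+1) b a].
Proof.
move=> G hy nl nh r hx hb; have [r1 r2] := gap_flat G nl nh.
have rx : rect x x.+1 l h.
  split=> [//|i hi]; have [e|ne] := eqVneq i x; first by rewrite e.
  by have -> : i = x.+1 by lia.
case: hx => hx.
  have hx' : x <= x <= x.+1 by lia.
  by have [-> ->] := rect_union r rx hx hb hx' hy.
have hx' : x <= x.+1 <= x.+1 by lia.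
by have [-> ->] := rect_union r rx hx hb hx' hy.
Qed.

Lemma attached_up i j x l h : I i j -> I i j.+1 ->
  attached i j x l h <-> attached i j.+1 x l h.
Proof.
move=> Ij IjS; split=> -[i1 [i2 [b [a [r hi hj t]]]]]; exists i1, i2, b, a; split=> //;
  have [lt rI nb na] := r.2 i hi.
  have ne : j.+1 != a by apply: contraNneq na => <-.
  by lia.
by have ne : j.+1 != b; [apply: contraNneq nb => <-|lia].
Qed.

Lemma attached_flat x y l h x' l' h' : gap x l h -> l <= y < h ->
  ~~ low_notch x l -> ~~ high_notch x h ->
  attached x y x' l' h' <-> attached x.+1 y x' l' h'.
Proof.
move=> G hy nl nh; split=> -[i1 [i2 [b [a [r hi hj t]]]]].
  have [_ _ r'] := rect_flat_extend G hy nl nh r (or_introl hi) hj.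
  exists (minn i1 x), (maxn i2 x.+1), b, a; split=> //; first lia.
  by move: t; rewrite /gap_touches; lia.
have [_ _ r'] := rect_flat_extend G hy nl nh r (or_intror hi) hj.
exists (minn i1 x), (maxn i2 x.+1), b, a; split=> //; first lia.
by move: t; rewrite /gap_touches; lia.
Qed.

Definition region_connected := forall Q, adjacency_invariant I Q ->
  forall x y x' y', I x y -> I x' y' -> Q x y -> Q x' y'.
Hypothesis connI : region_connected.

(** Coverage and linkage spread together: the first clause serves [guards_cover], the second
    [guards_connected]. *)
Let good g0 x y :=
  (exists x' l h g, attached x y x' l h /\ guards_gap x' l h g) /\
  (forall x' l h g, attached x y x' l h -> guards_gap x' l h g -> con g0 g).

(** Attached gaps do not change when moving vertically or across a gap without notches. A gap with a
    notch carries a guard attached to the cells on both sides, which links the guards of one cell to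
    those of the other. *)
Let good_invariant g0 : adjacency_invariant I (good g0).
Proof.
split=> x y I1 I2; last first.
  have E x' l h := @attached_up x y x' l h I1 I2.
  by split=> -[[x' [l [h [g [A G]]]]] H]; (split; [exists x', l, h, g; split=> //; apply/E
    |move=> ? ? ? ? /E; apply: H]).
have [l [h [G hy]]] := gap_exists I1 I2.
have [A1 A2] := attached_gap G hy.
case: (boolP (low_notch x l || high_notch x h)) => [nn|]; last first.
  rewrite negb_or => /andP[nl nh].
  have E x' l' h' := @attached_flat x y l h x' l' h' G hy nl nh.
  by split=> -[[x' [l' [h' [g [A G']]]]] H]; (split; [exists x', l', h', g; split=> //; apply/E
    |move=> ? ? ? ? /E; apply: H]).
have [g Gg] : exists g, guards_gap x l h g.
  case/orP: nn => nn; first by exists (x.+1, h, false); split=> //; left.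
  by exists (x.+1, l, true); split=> //; right.
split=> -[_ H]; (split; first by exists x, l, h, g).
  by move=> x' l' h' g' A G'; apply: rt_trans (H _ _ _ _ A1 Gg) (attached_con A2 A Gg G').
by move=> x' l' h' g' A G'; apply: rt_trans (H _ _ _ _ A2 Gg) (attached_con A1 A Gg G').
Qed.

Let good_all g0 x y : g0 \in s -> I x y -> good g0 x y.
Proof.
move=> /sP[x0 [l [h [G D]]]] Ixy.
have hl : l <= l < h by case: G; lia.
have [A _] := attached_gap G hl.
have /andP[I0 _] : I x0 l && I x0.+1 l by case: G => _ op _ _; apply: op.
apply: (connI (good_invariant g0) I0 Ixy); split; first by exists x0, l, h, g0.
by move=> x' l' h' g' A' G'; apply: attached_con A A' _ G'.
Qed.

Lemma guards_connected : lconnected s.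
Proof.
move=> g0 g g0s /sP[x [l [h [G D]]]].
have hl : l <= l < h by case: G; lia.
have [A _] := attached_gap G hl.
have /andP[I0 _] : I x l && I x.+1 l by case: G => _ op _ _; apply: op.
by have [_ H] := good_all g0s I0; apply: H A _.
Qed.

(** If the attached guard turns its back to the cell, it does not stand at the top or bottom of the
    rectangle. Its own end of the chord is then a notch too, and the opposite guard of the chord
    faces the cell. *)
Lemma guards_cover g0 x y : g0 \in s -> I x y -> exists2 g, g \in s & covers g x y.
Proof.
move=> g0s Ixy; have [[x' [l [h [g [A [G D]]]]]] _] := good_all g0s Ixy.
move: A => [i1 [i2 [b [a [r hi hj t]]]]].
have [lt _ _ _] := G; have [nb na] := gap_notch G r t.
have /and3P[tx tl th] := t.
have cover g1 : guards_gap x' l h g1 -> faces g1 y -> faces g1 y.+1 ->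
    exists2 g, g \in s & covers g x y.
  move=> D1 f1 f2; exists g1; first by apply/sP; exists x', l, h.
  exists i1, i2, b, a; split=> //; last by rewrite f1.
  by case: D1 => _ [] [_ ->]; rewrite /stands_in /=; lia.
case: D => -[n _].
  have [le|gt] := leqP y.+1 h.
    by apply: (cover (x'.+1, h, false)); [split=> //; left|rewrite /faces /=; lia..].
  have nh : high_notch x' h by apply: na; lia.
  by apply: (cover (x'.+1, l, true)); [split=> //; right|rewrite /faces /=; lia..].
have [le|gt] := leqP l y.
  by apply: (cover (x'.+1, l, true)); [split=> //; right|rewrite /faces /=; lia..].
have nl : low_notch x' l by apply: nb; lia.
by apply: (cover (x'.+1, h, false)); [split=> //; left|rewrite /faces /=; lia..].
Qed.

End Attached.

Lemma guard_stands x l h g : guards_gap x l h g ->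
  exists i1 i2 b a, rect i1 i2 b a /\ stands_in g i1 i2 b a.
Proof.
move=> [G D]; have hl : l <= l < h by case: G; lia.
have [[i1 [i2 [b [a [r hi hj t]]]]] _] := attached_gap G hl.
exists i1, i2, b, a; split=> //; move: t; rewrite /gap_touches.
by case: D => -[_ ->]; rewrite /stands_in /=; lia.
Qed.

(** A point with three inside cells ends exactly one gap, hence yields one guard. If there is no
    such point, no gap has a notch: the region is one rectangle, and a guard on its base
    suffices. *)
Lemma lattice_guards x1 y1 (M := N.+1) : region_connected -> I x1 y1 ->
  exists s : seq lguard,
  [/\ 0 < size s <= maxn 1 (\sum_(x < M) \sum_(y < M) reflex I x y),
      {in s, forall g, exists i1 i2 b a, rect i1 i2 b a /\ stands_in g i1 i2 b a},
      forall x y, I x y -> exists2 g, g \in s & covers g x y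
    & lconnected s].
Proof.
move=> connI I1.
pose t := [seq p <- [seq (x, y) | x <- iota 0 M, y <- iota 0 M] | reflex I p.1 p.2].
have st : size t = \sum_(x < M) \sum_(y < M) reflex I x y.
  rewrite size_filter -sum1_count big_mkcond big_allpairs.
  have -> : iota 0 M = index_iota 0 M by rewrite /index_iota subn0.
  rewrite big_mkord; apply: eq_bigr => x _.
  by rewrite big_mkord; apply: eq_bigr => y _; case: reflex.
(* The pair [p] names the upper right vertex of the cell [p], whence the height [p.2.+1] for the
   notched end of the gap. *)
pose rel (p : nat * nat) (g : lguard) := (exists h, gap p.1 p.2.+1 h /\
    low_notch p.1 p.2.+1 /\ g = (p.1.+1, h, false)) \/
  (exists l, gap p.1 l p.2.+1 /\ high_notch p.1 p.2.+1 /\ g = (p.1.+1, l, true)).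
have [|s [ss sP]] := @seq_of_functional_rel _ _ rel t.
  move=> [x y]; rewrite mem_filter /= => /andP[+ _].
  rewrite /reflex /quad => q3; rewrite /rel /=.
  have [/andP[c1 c2]|nop] := boolP (I x y.+1 && I x.+1 y.+1).
    have [l [h [G hy]]] := gap_exists c1 c2.
    have ly : l = y.+1.
      case: G => _ op _ _; apply/eqP; rewrite eqn_leq; apply/andP; split; first lia.
      rewrite ltnNge; apply/negP => le.
      have /andP[c3 c4] : I x y && I x.+1 y by apply: op; lia.
      by move: q3; rewrite c1 c2 c3 c4.
    subst l; exists (x.+1, h, false); split.
      by left; exists h; split=> //; split=> //; move: q3; rewrite /low_notch /= c1 c2;
        do 2!case: (I _ _).
    move=> g' [[h' [G' [_ ->]]]|[l' [[_ _ _ nop] _]]]; first by rewrite (gap_high_unique G G').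
    by rewrite c1 c2 in nop.
  have [c1 c2] : I x y /\ I x.+1 y.
    by move: q3 nop; do 4!case: (I _ _).
  have [l [h [G hy]]] := gap_exists c1 c2.
  have hyS : h = y.+1.
    case: G => _ op _ _; apply/eqP; rewrite eqn_leq; apply/andP; split; last lia.
    rewrite leqNgt; apply/negP => lt; move: nop; rewrite op //; lia.
  subst h; exists (x.+1, l, true); split.
    right; exists l; split=> //; split=> //; move: q3; rewrite /high_notch c1 c2.
    by do 2!case: (I _ _).
  move=> g' [[h' [[lt op _ _] _]]|[l' [G' [_ ->]]]].
    by move: nop; rewrite op //; lia.
  by rewrite (gap_low_unique G G').
have sP' g : g \in s <-> exists x l h, guards_gap x l h g.
  rewrite sP; split=> [[[x y] [_ [[h [G [n ->]]]|[l [G [n ->]]]]]]|[x [l [h [G D]]]]].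
  - by exists x, y.+1, h; split=> //; left.
  - by exists x, l, y.+1; split=> //; right.
  have l0 := gap_low_pos G; have [lt op nl nh] := G.
  have inM z w : I z w -> z < M /\ w < M := @cells_lt _ _ boxI z w.
  have mem_t z w : reflex I z w -> I z w || I z.+1 w -> (z, w) \in t.
    move=> rf Izw; rewrite mem_filter rf; apply/allpairsP; exists (z, w).
    by rewrite !mem_iota /= !add0n; case/orP: Izw => /inM[]; split=> //; lia.
  case: D => -[n ->].
    exists (x, l.-1); split.
      have := op l; rewrite leqnn lt => /(_ isT) /andP[c1 c2].
      apply: mem_t => //; move: n nl; rewrite /low_notch /reflex /quad prednK // c1 c2.
      by do 2!case: (I _ _).
    by left; exists h; rewrite /= prednK.
  have hE : h = h.-1.+1 by lia.
  have := op h.-1; rewrite -ltnS -hE leqnn andbT => /(_ lt) /andP[c1 c2].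
  exists (x, h.-1); split.
    apply: mem_t; last by rewrite c1.
    move: n nh; rewrite /high_notch /reflex /quad -hE c1 c2.
    by do 2!case: (I _ _).
  by right; exists l; rewrite /= -hE.
have [/eqP s0|] := boolP (s == [::]); last first.
  case es: s => [//|g0 s'] _.
  have g0s : g0 \in s by rewrite es mem_head.
  exists s; split.
  - by rewrite leq_max ss st leqnn orbT andbT -st -ss es.
  - by move=> g /sP'[x [l [h G]]]; apply: guard_stands G.
  - by move=> x y; apply: guards_cover sP' connI g0 x y g0s.
  - exact: guards_connected.
have flat x l h : gap x l h -> ~~ low_notch x l /\ ~~ high_notch x h.
  move=> G; suff no g : ~ guards_gap x l h g.
    split; apply/negP => n; first by apply: (no (x.+1, h, false)); split=> //; left.
    by apply: (no (x.+1, l, true)); split=> //; right.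
  by move=> Gg; have /sP' : exists x l h, guards_gap x l h g; [exists x, l, h|rewrite s0].
have [b [a [r hy]]] := run_exists I1.
have r1 : rect x1 x1 b a by split=> // i hi; have -> : i = x1 by lia.
pose g0 : lguard := (x1, b, true).
(* A rectangle around column [x1], of fixed heights [b] and [a], is widened until it reaches a given
   cell. *)
pose Q x y := exists i1 i2, [/\ rect i1 i2 b a, i1 <= x1 <= i2, i1 <= x <= i2 & b <= y < a].
have Qinv : adjacency_invariant I Q.
  split=> x y Ixy Ixy'; last first.
    by split=> -[i1 [i2 [[le r'] h1 hx hb]]]; exists i1, i2; split=> //; have [lt rI nb na] := r' x hx;
      [have ne : y.+1 != a by apply: contraNneq na => <-|have ne : y.+1 != b by apply: contraNneq nb => <-]; lia.
  have [l [h [G hg]]] := gap_exists Ixy Ixy'; have [nl nh] := flat _ _ _ G.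
  split=> -[i1 [i2 [r' h1 hx hb]]].
    have [_ _ r''] := rect_flat_extend G hg nl nh r' (or_introl hx) hb.
    by exists (minn i1 x), (maxn i2 x.+1); split=> //; lia.
  have [_ _ r''] := rect_flat_extend G hg nl nh r' (or_intror hx) hb.
  by exists (minn i1 x), (maxn i2 x.+1); split=> //; lia.
exists [:: g0]; split.
- by rewrite /= leq_max.
- by move=> g; rewrite inE => /eqP->; exists x1, x1, b, a; split=> //; rewrite /stands_in /=; case: r; lia.
- move=> x y Ixy; exists g0; first exact: mem_head.
  have [|i1 [i2 [r' h1 hx hb]]] := connI Q Qinv _ _ _ _ I1 Ixy.
    by exists x1, x1; split=> //; lia.
  by exists i1, i2, b, a; split=> //; rewrite /stands_in /faces /=; lia.
- by move=> g g'; rewrite !inE => /eqP-> /eqP->; apply: rt_refl.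
Qed.

End Guards.

Local Open Scope classical_set_scope.
Local Open Scope ring_scope.

(** * The region as a union of cells *)

Section Coordinates.
Variables (R : realType) (w : R * R).
Hypothesis w0 : w != 0.
Implicit Types z u : R * R.

Definition perp (w : R * R) : R * R := (- w.2, w.1).
(* Rotated coordinates, both scaled by the norm of [w]. *)
Definition coord (k : bool) z := if k then dotp (perp w) z else dotp w z.
Let sqw := w.1 ^+ 2 + w.2 ^+ 2.
(** Division by the squared norm undoes the scaling of the coordinates, so [w] need not be
    normalised by a square root. *)
Definition point_at (s t : R) : R * R :=
  ((s * w.1 - t * w.2) / sqw, (s * w.2 + t * w.1) / sqw).

Let sqw_gt0 : 0 < sqw.
Proof.
rewrite /sqw lt_neqAle addr_ge0 ?sqr_ge0 // andbT eq_sym.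
rewrite paddr_eq0 ?sqr_ge0 // !sqrf_eq0.
by move: w0; case: (w) => w1 w2; rewrite -pair_eqE.
Qed.

Lemma coordF_at s t : coord false (point_at s t) = s.
Proof.
have := lt0r_neq0 sqw_gt0; rewrite /coord /dotp /point_at /sqw /= => h.
by field.
Qed.

Lemma coordT_at s t : coord true (point_at s t) = t.
Proof.
have := lt0r_neq0 sqw_gt0; rewrite /coord /dotp /point_at /perp /sqw /= => h.
by field.
Qed.

Lemma coordK z : point_at (coord false z) (coord true z) = z.
Proof.
have := lt0r_neq0 sqw_gt0; case: z => z1 z2.
rewrite /coord /dotp /point_at /perp /sqw /= => h.
by congr pair; field.
Qed.

Lemma coord_comb k t z u :
  coord k ((1 - t) *: z + t *: u) = (1 - t) * coord k z + t * coord k u.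
Proof. by case: k; rewrite /coord /dotp /perp /= /GRing.scale /=; ring. Qed.

Lemma coord_continuous k : continuous (coord k).
Proof.
have dot (v : R * R) : continuous (dotp v).
  move=> z; rewrite /dotp.
  apply: cvgD; apply: cvgM; try exact: cvg_cst; [exact: cvg_fst|exact: cvg_snd].
by case: k; apply: dot.
Qed.

Lemma segmentP z u p : segment z u p <->
  exists t, 0 <= t <= 1 /\ p = (1 - t) *: z + t *: u.
Proof.
split=> [[t /= t01 <-]|[t [t01 ->]]]; exists t => //; move: t01; by rewrite in_itv /=.
Qed.

Lemma coord_segment k z u p m M : segment z u p ->
  m <= coord k z <= M -> m <= coord k u <= M -> m <= coord k p <= M.
Proof.
move=> /segmentP[t [/andP[t0 t1] ->]] /andP[z1 z2] /andP[u1 u2].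
by rewrite coord_comb; apply/andP; split; nra.
Qed.

Lemma coord_segment_lt k z u p m M : segment z u p ->
  m < coord k z < M -> m < coord k u < M -> m < coord k p < M.
Proof.
move=> /segmentP[t [/andP[t0 t1] ->]] /andP[z1 z2] /andP[u1 u2].
have [e|t1'] : t = 1 \/ t < 1 by move: t1; rewrite le_eqVlt => /orP[/eqP|]; auto.
  by rewrite coord_comb e subrr mul0r add0r mul1r u1 u2.
by rewrite coord_comb; apply/andP; split; nra.
Qed.

(** Serves to join a point on the rim of a cell to its centre: the open cell is entered at once. *)
Lemma coord_segment_open z u p : segment z u p -> p = z \/
  forall k m M, m <= coord k z <= M -> m < coord k u < M -> m < coord k p < M.
Proof.
move=> /segmentP[t [/andP[t0 t1] ->]].
have [e|t0'] : t = 0 \/ 0 < t by move: t0; rewrite le_eqVlt => /orP[/eqP|]; auto.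
  by left; rewrite e subr0 scale1r scale0r addr0.
right=> k m M /andP[z1 z2] /andP[u1 u2].
by rewrite coord_comb; apply/andP; split; nra.
Qed.

Lemma segment_connected_component (B : set (R * R)) z u :
  segment z u `<=` ~` B -> connected_component (~` B) z u.
Proof.
move=> sB; apply: (@connected_component_max _ _ (segment z u)) => //.
- by apply/segmentP; exists 0; rewrite lexx ler01 subr0 scale1r scale0r addr0.
- apply: connected_continuous_connected; first exact: segment_connected.
  apply: continuous_subspaceT => t.
  apply: cvgD; (apply: cvgZr_tmp || apply: cvgZ); try exact: cvg_cst; [|exact: cvg_id].
  by apply: cvgB; [exact: cvg_cst|exact: cvg_id].
- by apply/segmentP; exists 1; rewrite lexx ler01 subrr scale1r scale0r add0r.
Qed.

Let K := `|w.1| + `|w.2|.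

Lemma coord_le_norm k z : `|coord k z| <= K * `|z|.
Proof.
have [h1 h2] : `|z.1| <= `|z| /\ `|z.2| <= `|z|.
  by rewrite /Num.norm /= !le_max !lexx orbT.
have n1 := normr_ge0 w.1; have n2 := normr_ge0 w.2.
rewrite /coord /dotp /perp /K; case: k => /=;
  rewrite (le_trans (ler_normD _ _)) // !normrM ?normrN; nra.
Qed.

Lemma norm_le_coord z : `|z| <= K / sqw * (`|coord false z| + `|coord true z|).
Proof.
rewrite -[X in `|X| <= _](coordK z) /point_at.
set s := coord false z; set t := coord true z.
have n1 := normr_ge0 w.1; have n2 := normr_ge0 w.2.
have n3 := normr_ge0 s; have n4 := normr_ge0 t.
have i0 : 0 <= sqw^-1 by rewrite invr_ge0 ltW.
rewrite {1}/Num.norm /= ge_max !normrM (ger0_norm i0) [K / _ * _]mulrAC !ler_wpM2r //.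
  rewrite (le_trans (ler_normD _ _)) // !normrM; rewrite /K; nra.
rewrite (le_trans (ler_normB _ _)) // !normrM; rewrite /K; nra.
Qed.

End Coordinates.
Arguments coord : simpl never.

(** * Position of a real number among the grid lines *)

Definition between (R : realType) (p q u : R) := (p <= u <= q) || (q <= u <= p).

Section Locate.
Variables (R : realType) (X : nat -> R).
Hypothesis Xinc : {mono X : m n / (m < n)%N >-> m < n}.

Lemma Xle : {mono X : m n / (m <= n)%N >-> m <= n}.
Proof. by move=> m n; rewrite leNgt Xinc -leqNgt. Qed.

Lemma Xinj : injective X.
Proof. by move=> m n e; apply/eqP; rewrite eqn_leq -!Xle e lexx. Qed.

Lemma locate i j u : (i < j)%N -> X i <= u <= X j ->
  exists k, (i <= k < j)%N /\ X k <= u <= X k.+1.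
Proof.
move=> ij /andP[Xi Xj].
have : exists k, (k < j)%N && (u <= X k.+1).
  by exists j.-1; rewrite prednK ?Xj ?andbT; lia.
move=> /ex_minnP[k /andP[kj uk] kmin].
have [le|lt] := leqP i k.
  exists k; split; first lia.
  rewrite uk andbT; have [->//|ne] := eqVneq k i.
  rewrite leNgt; apply/negP => lt.
  by have := kmin k.-1; rewrite prednK; [rewrite (ltW lt); lia|lia].
exists i; split; first lia.
by rewrite Xi (le_trans uk) // Xle ltnS ltnW.
Qed.

(** When [u] is a grid value, the interval shared with [t] depends on the side on which [t] lies;
    [0 < x] provides one on the left. *)
Lemma neighbourhood_cells x u : (0 < x)%N -> X x <= u <= X x.+1 ->
  exists lo hi, lo < u < hi /\ forall t, lo < t < hi ->
    exists x', X x' <= t <= X x'.+1 /\ X x' <= u <= X x'.+1.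
Proof.
move=> x0 /andP[u1 u2].
have lt1 k : X k < X k.+1 by rewrite Xinc.
have xp : x.-1.+1 = x by rewrite prednK.
have l0 := lt1 x.-1; rewrite xp in l0.
have [e1|n1] : u = X x \/ X x < u.
  by move: u1; rewrite le_eqVlt => /orP[/eqP|]; auto.
- exists (X x.-1), (X x.+1); rewrite e1 l0 lt1; split=> // t /andP[t1 t2].
  have [le|lt] := leP t (X x).
    by exists x.-1; rewrite xp le (ltW t1) lexx (ltW l0).
  by exists x; rewrite (ltW lt) (ltW t2) lexx (ltW (lt1 x)).
have [e2|n2] : u = X x.+1 \/ u < X x.+1.
  by move: u2; rewrite le_eqVlt => /orP[/eqP|]; auto.
- exists (X x), (X x.+2); rewrite e2 !lt1; split=> // t /andP[t1 t2].
  have [le|lt] := leP t (X x.+1).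
    by exists x; rewrite le (ltW t1) lexx (ltW (lt1 x)).
  by exists x.+1; rewrite (ltW lt) (ltW t2) lexx (ltW (lt1 x.+1)).
exists (X x), (X x.+1); rewrite n1 n2; split=> // t /andP[t1 t2].
by exists x; rewrite !ltW.
Qed.

Lemma between_locate i j u : i != j -> between (X i) (X j) u ->
  exists k, ((i <= k)%N (+) (j <= k)%N) /\ X k <= u <= X k.+1.
Proof.
rewrite /between => ne /orP[] h.
  have ij : (i <= j)%N by rewrite -Xle; case/andP: h => /le_trans; apply.
  by have [|k [hk hu]] := @locate i j u _ h; [lia|exists k; split=> //; lia].
have ij : (j <= i)%N by rewrite -Xle; case/andP: h => /le_trans; apply.
by have [|k [hk hu]] := @locate j i u _ h; [lia|exists k; split=> //; lia].
Qed.

Lemma between_span i j k u : ((i <= k)%N (+) (j <= k)%N) -> X k <= u <= X k.+1 ->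
  between (X i) (X j) u.
Proof.
rewrite /between => h /andP[u1 u2].
have [ik|ik] := leqP i k; apply/orP; [left|right]; apply/andP; split.
- by apply: le_trans u1; rewrite Xle.
- by apply: (le_trans u2); rewrite Xle; move: h; rewrite ik; lia.
- by apply: le_trans u1; rewrite Xle; lia.
- by apply: (le_trans u2); rewrite Xle.
Qed.

Lemma between_open i j k u : between (X i) (X j) u -> X k < u < X k.+1 ->
  (i <= k)%N (+) (j <= k)%N.
Proof.
rewrite /between => + /andP[u1 u2].
move=> /orP[] /andP[h1 h2].
  have l1 : (i < k.+1)%N by rewrite -Xinc (le_lt_trans h1).
  have l2 : (k < j)%N by rewrite -Xinc (lt_le_trans u1).
  by lia.
have l1 : (j < k.+1)%N by rewrite -Xinc (le_lt_trans h1).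
have l2 : (k < i)%N by rewrite -Xinc (lt_le_trans u1).
by lia.
Qed.

Lemma open_not_node i k u : X k < u < X k.+1 -> u != X i.
Proof. by move=> /andP[u1 u2]; apply/eqP => e; move: u1 u2; rewrite e !Xinc; lia. Qed.

Lemma closed_adjacent x x' u : X x <= u <= X x.+1 -> X x' <= u <= X x'.+1 ->
  [\/ x' = x, x' = x.+1 | x = x'.+1].
Proof.
move=> /andP[a1 a2] /andP[b1 b2].
have : (x <= x'.+1)%N by rewrite -Xle (le_trans a1).
have : (x' <= x.+1)%N by rewrite -Xle (le_trans b1).
have [->|ne] := eqVneq x' x; first by constructor 1.
have [->|ne1] := eqVneq x' x.+1; first by constructor 2.
by move=> h1 h2; constructor 3; lia.
Qed.

End Locate.

Section Sides.
Variables (R : realType) (n : nat) (v : 'I_n -> R * R).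
Variables (w : R * R) (X Y : nat -> R) (a b : 'I_n -> nat).
Hypothesis w0 : w != 0.
Hypotheses (Xinc : {mono X : i j / (i < j)%N >-> i < j})
           (Yinc : {mono Y : i j / (i < j)%N >-> i < j}).
Hypotheses (va : forall i, coord w false (v i) = X (a i))
           (vb : forall i, coord w true (v i) = Y (b i)).
Hypothesis ax : forall i, (a i == a (ordS i)) = (b i != b (ordS i)).

Lemma coord_between k z u p : segment z u p ->
  between (coord w k z) (coord w k u) (coord w k p).
Proof.
move=> s; rewrite /between.
have [le|lt] := leP (coord w k z) (coord w k u).
  by apply/orP; left; apply: (coord_segment s); rewrite lexx ?le.
by apply/orP; right; apply: (coord_segment s); rewrite lexx ?(ltW lt).
Qed.

Lemma axis_segment k z u p : coord w k z = coord w k u ->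
  coord w k p = coord w k z -> coord w (~~ k) z != coord w (~~ k) u ->
  between (coord w (~~ k) z) (coord w (~~ k) u) (coord w (~~ k) p) ->
  segment z u p.
Proof.
move=> ezu ep ne bt; apply/segmentP.
set s := coord w (~~ k) z in ne bt; set t := coord w (~~ k) u in ne bt.
set q := coord w (~~ k) p in bt.
have st : t - s != 0 by rewrite subr_eq0 eq_sym.
pose l := (q - s) / (t - s).
have ql : q = (1 - l) * s + l * t by rewrite /l; field.
exists l; split.
  have [lt|lt|e] := ltgtP s t; last by rewrite e subrr eqxx in st.
    have ts : 0 < t - s by rewrite subr_gt0.
    by rewrite /l divr_ge0 ?ler_pdivrMr //=; move: bt; rewrite /between; lra.
  have ts : 0 < s - t by rewrite subr_gt0.
  have -> : l = (s - q) / (s - t) by rewrite /l -[q - s]opprB -[t - s]opprB invrN mulrNN.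
  by rewrite divr_ge0 ?ler_pdivrMr //=; move: bt; rewrite /between; lra.
rewrite -(coordK w0 p) -(coordK w0 ((1 - l) *: z + l *: u)) !coord_comb.
have {}ql : coord w (~~ k) p = (1 - l) * coord w (~~ k) z + l * coord w (~~ k) u by [].
clearbody l; clear st ne bt q s t; move: ezu ep ql.
by case: k => /= <- -> ->; congr point_at; ring.
Qed.

Lemma between_same (p u : R) : between p p u -> u = p.
Proof. by rewrite /between orbb => /andP[? ?]; apply/eqP; rewrite eq_le; apply/andP. Qed.

Lemma side_coordP i z : side v i z <-> between (X (a i)) (X (a (ordS i))) (coord w false z) /\
  between (Y (b i)) (Y (b (ordS i))) (coord w true z).
Proof.
split=> [s|[]].
  by rewrite -!va -!vb; split; apply: coord_between.
have := ax i.
case: (a i =P a (ordS i)) => [e /esym nb|ne /esym/negbFE/eqP e] h1 h2.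
  apply: (@axis_segment false); rewrite /= ?va ?vb -?e //.
    by move: h1; rewrite -e => /between_same.
  by apply: contra nb => /eqP/(Xinj Yinc)->.
apply: (@axis_segment true); rewrite /= ?va ?vb -?e //.
  by move: h2; rewrite -e => /between_same.
by apply/eqP => /(Xinj Xinc).
Qed.

End Sides.

(** * The region bounded by the curve is the union of the inside cells *)

Section Region.
Variables (R : realType) (n : nat) (v : 'I_n -> R * R).
Variables (w : R * R) (X Y : nat -> R) (a b : 'I_n -> nat).
Hypothesis w0 : w != 0.
Hypotheses (Xinc : {mono X : i j / (i < j)%N >-> i < j})
           (Yinc : {mono Y : i j / (i < j)%N >-> i < j}).
Hypotheses (va : forall i, coord w false (v i) = X (a i))
           (vb : forall i, coord w true (v i) = Y (b i)).
Hypothesis lp : lattice_polygon a b.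
Local Notation xi := (coord w false).
Local Notation eta := (coord w true).
Let I := cell a b.
Let B := polygon_boundary v.
Let N := lattice_bound a b.

Let sideP := side_coordP w0 Xinc Yinc va vb (let: And4 _ ax _ _ := lp in ax).

Definition in_cell x y (z : R * R) :=
  X x <= coord w false z <= X x.+1 /\ Y y <= coord w true z <= Y y.+1.

Lemma boundaryP z : B z <-> exists i, side v i z.
Proof. by split=> [[i _ s]|[i s]]; exists i. Qed.

Lemma open_cell_off x y z : X x < xi z < X x.+1 -> Y y < eta z < Y y.+1 -> ~ B z.
Proof.
move=> hx hy /boundaryP[i /sideP[h1 h2]].
have [_ ax _ _] := lp; have := ax i.
case: (a i =P a (ordS i)) => [e _|ne /esym/negbFE/eqP e].
  by move: h1; rewrite -e => /between_same h; have := open_not_node Xinc (a i) hx; rewrite h eqxx.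
by move: h2; rewrite -e => /between_same h; have := open_not_node Yinc (b i) hy; rewrite h eqxx.
Qed.

Lemma hedge_flip x y z : X x < xi z < X x.+1 -> eta z = Y y.+1 -> B z ->
  I x y.+1 (+) I x y.
Proof.
move=> hx hy /boundaryP[i /sideP[h1 h2]].
have hs := between_open Xinc h1 hx.
have [ne e] := hspan_axis lp hs.
rewrite cell_flip_up //; apply/existsP; exists i; rewrite /hspan hs /=.
by move: h2; rewrite -e hy => /between_same /(Xinj Yinc) ->.
Qed.

Lemma vedge_flip x y z : xi z = X x.+1 -> Y y < eta z < Y y.+1 -> B z ->
  I x.+1 y (+) I x y.
Proof.
move=> hx hy /boundaryP[i /sideP[h1 h2]].
have hs := between_open Yinc h2 hy.
have [e ne] := vspan_axis lp hs.
rewrite cell_flip_right //; apply/existsP; exists i; rewrite /vspan hs /=.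
by move: h1; rewrite -e hx => /between_same /(Xinj Xinc) ->.
Qed.

Lemma hedge_boundary x y z : I x y.+1 (+) I x y ->
  X x <= xi z <= X x.+1 -> eta z = Y y.+1 -> B z.
Proof.
rewrite cell_flip_up // => /existsP[i /andP[hs /eqP bi]] hx hy.
apply/boundaryP; exists i; apply/sideP; split; first exact: between_span hx.
by have [_ <-] := hspan_axis lp hs; rewrite bi hy /between lexx.
Qed.

Lemma vedge_boundary x y z : I x.+1 y (+) I x y ->
  xi z = X x.+1 -> Y y <= eta z <= Y y.+1 -> B z.
Proof.
rewrite cell_flip_right // => /existsP[i /andP[hs /eqP ai]] hx hy.
apply/boundaryP; exists i; apply/sideP; split; last exact: between_span hy.
by have [<- _] := vspan_axis lp hs; rewrite ai hx /between lexx.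
Qed.

Lemma boundary_in_cell z : B z -> exists x y, I x y /\ in_cell x y z.
Proof.
move=> /boundaryP[i /sideP[h1 h2]].
have [pos ax _ _] := lp; have := ax i; have [ap bp] := pos i.
have lt1 k : X k <= X k.+1 by rewrite (Xle Xinc).
have lt2 k : Y k <= Y k.+1 by rewrite (Xle Yinc).
case: (a i =P a (ordS i)) => [e /esym nb|/eqP ne /esym/negbFE/eqP e].
  have [y [hs hy]] := between_locate Yinc nb h2.
  have hx : xi z = X (a i).-1.+1 by move: h1; rewrite -e prednK // => /between_same.
  have : I (a i).-1.+1 y (+) I (a i).-1 y.
    by rewrite cell_flip_right //; apply/existsP; exists i; rewrite /vspan hs prednK ?eqxx.
  case e1 : (I (a i).-1.+1 y) => /= e2.
    by exists (a i).-1.+1, y; split=> //; split=> //; rewrite hx lexx lt1.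
  by exists (a i).-1, y; split=> //; split=> //; rewrite hx lexx lt1.
have [x [hs hx]] := between_locate Xinc ne h1.
have hy : eta z = Y (b i).-1.+1 by move: h2; rewrite -e prednK // => /between_same.
have : I x (b i).-1.+1 (+) I x (b i).-1.
  by rewrite cell_flip_up //; apply/existsP; exists i; rewrite /hspan hs prednK ?eqxx.
case e1 : (I x (b i).-1.+1) => /= e2.
  by exists x, (b i).-1.+1; split=> //; split=> //; rewrite hy lexx lt2.
by exists x, (b i).-1; split=> //; split=> //; rewrite hy lexx lt2.
Qed.

(** Closed cells sharing [z] differ by at most one step in each direction. Each step, first in [x]
    and then in [y], crosses a grid edge through [z], where a change of parity would put [z] on the
    boundary. *)
Lemma in_cell_same x y x' y' z : ~ B z -> in_cell x y z -> in_cell x' y' z ->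
  I x y = I x' y'.
Proof.
move=> nB [hx hy] [hx' hy'].
have neB (p q : bool) : (p (+) q -> B z) -> p = q by case: p; case: q => // /(_ isT).
transitivity (I x' y).
  have eqX k : X k.+1 <= xi z -> xi z <= X k.+1 -> xi z = X k.+1.
    by move=> h1 h2; apply/eqP; rewrite eq_le h1 h2.
  case: (closed_adjacent Xinc hx hx') => e; subst => //.
    apply/esym/neB => f; apply: (vedge_boundary f _ hy).
    by apply: eqX; [case/andP: hx'|case/andP: hx].
  by apply/neB => f; apply: (vedge_boundary f _ hy); apply: eqX; [case/andP: hx|case/andP: hx'].
have eqY k : Y k.+1 <= eta z -> eta z <= Y k.+1 -> eta z = Y k.+1.
  by move=> h1 h2; apply/eqP; rewrite eq_le h1 h2.
case: (closed_adjacent Yinc hy hy') => e; subst => //.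
  apply/esym/neB => f; apply: (hedge_boundary f hx').
  by apply: eqY; [case/andP: hy'|case/andP: hy].
by apply/neB => f; apply: (hedge_boundary f hx'); apply: eqY; [case/andP: hy|case/andP: hy'].
Qed.

Definition cell_union : set (R * R) := [set z | exists x y, I x y /\ in_cell x y z].

Let closed_cell x y : closed (in_cell x y).
Proof.
have cl k (c d : R) : closed [set z | c <= coord w k z <= d].
  have -> : [set z | c <= coord w k z <= d] = coord w k @^-1` `[c, d]%classic.
    by apply/seteqP; split=> z /=; rewrite in_itv.
  apply: preimage_closed; first by move=> z _; apply: coord_continuous.
  exact: interval_closed.
exact: closedI (cl false _ _) (cl true _ _).
Qed.

Lemma cell_union_closed : closed cell_union.
Proof.
have -> : cell_union = \bigcup_(p in `I_N `*` `I_N)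
    (if I p.1 p.2 then in_cell p.1 p.2 else set0).
  apply/seteqP; split=> [z [x [y [Ixy zc]]]|z [[x y] _ /=]].
    exists (x, y); last by rewrite /= Ixy.
    by have /and4P[_ _ ? ?] := cell_in_box lp Ixy.
  by case e: (I x y) => // zc; exists x, y.
apply: closed_bigcup; first exact: finite_setX.
by move=> [x y] _ /=; case: (I x y); [apply: closed_cell|apply: closed0].
Qed.

Lemma open_strip k (c d : R) : open [set z | c < coord w k z < d].
Proof.
have -> : [set z | c < coord w k z < d] = coord w k @^-1` `]c, d[%classic.
  by apply/seteqP; split=> z /=; rewrite in_itv.
apply: open_comp; first by move=> z _; apply: coord_continuous.
exact: interval_open.
Qed.

Lemma cell_union_nbhs z : cell_union z -> ~ B z -> cell_union^° z.
Proof.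
move=> [x [y [Ixy [hx hy]]]] nB.
have /and4P[x0 y0 _ _] := cell_in_box lp Ixy.
have [lo [hi [hz cov]]] := neighbourhood_cells Xinc x0 hx.
have [lo' [hi' [hz' cov']]] := neighbourhood_cells Yinc y0 hy.
apply: (@filterS _ (nbhs z) _ ([set u | lo < xi u < hi] `&` [set u | lo' < eta u < hi'])).
  move=> u [/cov[x' [ux zx]] /cov'[y' [uy zy]]]; exists x', y'; split=> //.
  by rewrite -/I -(@in_cell_same x y x' y' z).
by apply: open_nbhs_nbhs; split; [apply: openI; apply: open_strip|split].
Qed.

(** Off the boundary [cell_union] is both open and closed, so a connected set that meets it stays in
    it. *)
Lemma component_in_cells z : cell_union z -> ~ B z ->
  connected_component (~` B) z `<=` cell_union.
Proof.
move=> Cz nB u [A [Az AB Acon] Au].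
suff E : A `&` cell_union = A by move: Au; rewrite -E => -[].
apply: Acon.
- by exists z.
- exists cell_union^°; first exact: open_interior.
  apply/seteqP; split=> p [Ap Cp]; split=> //; last exact: interior_subset.
  by apply: cell_union_nbhs => //; apply: AB.
- by exists cell_union; first exact: cell_union_closed.
Qed.

Lemma cell_union_bounded : exists M, forall z, cell_union z -> `|z| <= M.
Proof.
exists ((`|w.1| + `|w.2|) / (w.1 ^+ 2 + w.2 ^+ 2) *
  ((`|X 0| + `|X N|) + (`|Y 0| + `|Y N|))) => z [x [y [Ixy [/andP[x1 x2] /andP[y1 y2]]]]].
have /and4P[_ _ xN yN] := cell_in_box lp Ixy.
have bd (c d u : R) : c <= u <= d -> `|u| <= `|c| + `|d|.
  move=> /andP[cu ud]; rewrite ler_norml.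
  have := ler_norm c; have := ler_norm d; have := ler_norm (- c); rewrite normrN.
  by have := normr_ge0 c; have := normr_ge0 d; lra.
apply: le_trans (norm_le_coord w0 z) _; apply: ler_wpM2l.
  by rewrite divr_ge0 ?addr_ge0 ?sqr_ge0.
apply: lerD; apply: bd.
  by rewrite (le_trans _ x1) ?(le_trans x2) ?(Xle Xinc).
by rewrite (le_trans _ y1) ?(le_trans y2) ?(Xle Yinc).
Qed.

Let mid x y := point_at w ((X x + X x.+1) / 2) ((Y y + Y y.+1) / 2).

Let mid_in x y : X x < xi (mid x y) < X x.+1 /\ Y y < eta (mid x y) < Y y.+1.
Proof.
have lt1 : X x < X x.+1 by rewrite Xinc.
have lt2 : Y y < Y y.+1 by rewrite Yinc.
by rewrite /mid coordF_at // coordT_at //; lra.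
Qed.

Let mid_off x y : ~ B (mid x y).
Proof. by have [h1 h2] := mid_in x y; apply: open_cell_off h1 h2. Qed.

Lemma mid_right x y : I x y = I x.+1 y ->
  segment (mid x y) (mid x.+1 y) `<=` ~` B.
Proof.
move=> e p s; have [h1 h2] := mid_in x y; have [h3 h4] := mid_in x.+1 y.
have hy := coord_segment_lt s h2 h4.
have /andP[x1 x2] : X x < xi p < X x.+2.
  apply: (coord_segment_lt s).
    by case/andP: h1 => -> h; rewrite (lt_trans h) ?Xinc.
  by case/andP: h3 => h ->; rewrite (lt_trans _ h) ?Xinc.
have [lt|gt|eq] := ltgtP (xi p) (X x.+1).
- exact: (@open_cell_off x y p (introT andP (conj x1 lt)) hy).
- exact: (@open_cell_off x.+1 y p (introT andP (conj gt x2)) hy).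
- by move=> /(vedge_flip eq hy); rewrite e addbb.
Qed.

Lemma mid_up x y : I x y = I x y.+1 ->
  segment (mid x y) (mid x y.+1) `<=` ~` B.
Proof.
move=> e p s; have [h1 h2] := mid_in x y; have [h3 h4] := mid_in x y.+1.
have hx := coord_segment_lt s h1 h3.
have /andP[y1 y2] : Y y < eta p < Y y.+2.
  apply: (coord_segment_lt s).
    by case/andP: h2 => -> h; rewrite (lt_trans h) ?Yinc.
  by case/andP: h4 => h ->; rewrite (lt_trans _ h) ?Yinc.
have [lt|gt|eq] := ltgtP (eta p) (Y y.+1).
- exact: (@open_cell_off x y p hx (introT andP (conj y1 lt))).
- exact: (@open_cell_off x y.+1 p hx (introT andP (conj gt y2))).
- by move=> /(hedge_flip hx eq); rewrite e addbb.
Qed.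

Lemma outside_mid x y : ~~ I x y -> connected_component (~` B) (mid 0 0) (mid x y).
Proof.
apply: (cell_co_connected lp (Q := fun x y => connected_component (~` B) (mid 0 0) (mid x y)));
  last by apply: connected_component_refl; apply: mid_off.
split=> {}x {}y n1 n2.
  have e : I x y = I x.+1 y by rewrite /I (negbTE n1) (negbTE n2).
  have c := segment_connected_component (mid_right e).
  by split=> h; [exact: connected_component_trans h c|
    exact: connected_component_trans h (connected_component_sym c)].
have e : I x y = I x y.+1 by rewrite /I (negbTE n1) (negbTE n2).
have c := segment_connected_component (mid_up e).
by split=> h; [exact: connected_component_trans h c|
  exact: connected_component_trans h (connected_component_sym c)].
Qed.

Lemma in_cell_mid x y z : ~ B z -> in_cell x y z ->
  connected_component (~` B) z (mid x y).
Proof.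
move=> nB [hx hy]; apply: segment_connected_component => p.
move=> /(coord_segment_open w)[->//|h].
have [h1 h2] := mid_in x y.
exact: open_cell_off (h _ _ _ hx h1) (h _ _ _ hy h2).
Qed.

Lemma boundary_box z : B z -> X 1 <= xi z <= X N /\ Y 1 <= eta z <= Y N.
Proof.
move=> /boundaryP[i /sideP[h1 h2]].
have [pos _ _ _] := lp; have [p1 p2] := pos i; have [p3 p4] := pos (ordS i).
have [q1 q2] := lattice_bound_gt a b i; have [q3 q4] := lattice_bound_gt a b (ordS i).
split.
  have [b1 b2 b3 b4] : [/\ X 1 <= X (a i), X (a i) <= X N, X 1 <= X (a (ordS i)) & X (a (ordS i)) <= X N].
    by rewrite !(Xle Xinc); split=> //; rewrite ltnW.
  by move: h1; rewrite /between => /orP[] /andP[? ?]; apply/andP; split; lra.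
have [b1 b2 b3 b4] : [/\ Y 1 <= Y (b i), Y (b i) <= Y N, Y 1 <= Y (b (ordS i)) & Y (b (ordS i)) <= Y N].
  by rewrite !(Xle Yinc); split=> //; rewrite ltnW.
by move: h2; rewrite /between => /orP[] /andP[? ?]; apply/andP; split; lra.
Qed.

(** A point beyond one side of the box of the curve is joined straight to the centre of a corner
    cell beyond that same side. Any other point lies in an outside cell and is joined to its
    centre. *)
Lemma outside_component z : ~ B z -> ~ cell_union z ->
  connected_component (~` B) (mid 0 0) z.
Proof.
move=> nB nC.
have I0 x : ~~ I x 0 by rewrite /I (cellsx0 (cell_in_box lp)).
have I0' y : ~~ I 0 y by rewrite /I (cells0x (cell_in_box lp)).
have IN y : ~~ I N y by rewrite /I (cellsNx (cell_in_box lp)).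
have IN' x : ~~ I x N by rewrite /I (cellsxN (cell_in_box lp)).
have far x y : ~~ I x y -> segment (mid x y) z `<=` ~` B ->
    connected_component (~` B) (mid 0 0) z.
  by move=> /outside_mid h /segment_connected_component; apply: connected_component_trans.
have seg k x y p : segment (mid x y) z p -> 
    Num.min (coord w k (mid x y)) (coord w k z) <= coord w k p
      <= Num.max (coord w k (mid x y)) (coord w k z).
  by move=> s; apply: (coord_segment s); rewrite ge_min le_max lexx ?orbT.
have [x1|x1] := ltP (xi z) (X 1).
  apply: (far 0%N 0%N) => // p /(seg false) /andP[_ s] /boundary_box[/andP[h _] _].
  have [/andP[_ m] _] := mid_in 0 0.
  by move: (le_trans h s); rewrite le_max leNgt m /= leNgt x1.
have [x2|x2] := ltP (X N) (xi z).
  apply: (far N 0%N) => // p /(seg false) /andP[s _] /boundary_box[/andP[_ h] _].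
  have [/andP[m _] _] := mid_in N 0.
  by move: (le_trans s h); rewrite ge_min leNgt m /= leNgt x2.
have [y1|y1] := ltP (eta z) (Y 1).
  apply: (far 0%N 0%N) => // p /(seg true) /andP[_ s] /boundary_box[_ /andP[h _]].
  have [_ /andP[_ m]] := mid_in 0 0.
  by move: (le_trans h s); rewrite le_max leNgt m /= leNgt y1.
have [y2|y2] := ltP (Y N) (eta z).
  apply: (far 0%N N) => // p /(seg true) /andP[s _] /boundary_box[_ /andP[_ h]].
  have [_ /andP[m _]] := mid_in 0 N.
  by move: (le_trans s h); rewrite ge_min leNgt m /= leNgt y2.
have N1 : (0 < N)%N by [].
have Xz : X 0 <= xi z <= X N by rewrite x2 (le_trans _ x1) // (Xle Xinc).
have Yz : Y 0 <= eta z <= Y N by rewrite y2 (le_trans _ y1) // (Xle Yinc).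
have [x [_ hx]] := locate Xinc N1 Xz; have [y [_ hy]] := locate Yinc N1 Yz.
have nI : ~~ I x y by apply/negP => Ixy; apply: nC; exists x, y.
apply: connected_component_trans (outside_mid nI) _.
by apply: connected_component_sym; apply: in_cell_mid.
Qed.

Lemma outer_unbounded : ~ bounded_set (connected_component (~` B) (mid 0 0)).
Proof.
move=> [M0 [_ bnd]].
pose M := `|M0| + 1; pose K := `|w.1| + `|w.2|.
have M0M : M0 < M by have := ler_norm M0; rewrite /M; lra.
have K0 : 0 <= K * M by rewrite mulr_ge0 ?addr_ge0.
(* By [coord_le_norm], a first coordinate below [- K * M] forces a norm above [M]. The term in [X 1]
   puts the point to the left of the curve, like [mid 0 0]. *)
pose s := - (`|X 1| + K * M + 1); pose z := point_at w s ((Y 0 + Y 1) / 2).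
have s1 : s < X 1 by have := ler_norm (- X 1); rewrite normrN /s; lra.
have xz : xi z = s by rewrite /z coordF_at.
suff cz : connected_component (~` B) (mid 0 0) z.
  have := bnd M M0M z cz => /= zM.
  have := coord_le_norm w false z; rewrite xz normrN ger0_norm.
    by have := ler_wpM2l (_ : 0 <= K) zM; rewrite addr_ge0 // => /(_ isT); have := normr_ge0 (X 1); rewrite -/K; lra.
  by have := normr_ge0 (X 1); lra.
apply: segment_connected_component => p sp /boundary_box[/andP[h _] _].
have [/andP[m0 m] _] := mid_in 0 0.
have : Num.min (xi (mid 0 0)) (xi z) <= xi p <= Num.max (xi (mid 0 0)) (xi z).
  by apply: (coord_segment sp); rewrite ge_min le_max lexx ?orbT.
move=> /andP[_ /(le_trans h)]; rewrite le_max leNgt m /= leNgt xz s1 //.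
Qed.

(** A point that is neither on the curve nor in an inside cell shares the unbounded component of
    [mid 0 0]; the component of an inside point off the curve stays in the bounded [cell_union]. *)
Lemma region_cells : polygon_region v = cell_union.
Proof.
apply/seteqP; split=> z.
  case=> [/boundary_in_cell //|[nB bz]].
  have [//|nC] := pselect (cell_union z).
  case: outer_unbounded.
  by rewrite (same_connected_component (outside_component nB nC)).
move=> Cz; have [Bz|nB] := pselect (B z); first by left.
right; split=> //.
have [M bM] := cell_union_bounded.
exists M; split; first exact: num_real.
move=> M' ltM u cu /=; apply: le_trans (ltW ltM).
by apply: bM; apply: component_in_cells cu.
Qed.
End Region.

(** * Half-guards in the plane *)

Section Padding.
Variables (R : realType) (P : set (R * R)).

Lemma segment_xx (x : R * R) : segment x x = [set x].
Proof.
have e (t : R) : (1 - t) *: x + t *: x = x by rewrite -scalerDl subrK scale1r.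
apply/seteqP; split=> [_ [t _ <-]|_ ->]; first by rewrite e.
by apply/segmentP; exists 0; rewrite lexx ler01 e.
Qed.

Lemma half_guard_mem (g : guard R) : half_guard P g -> g.2 g.1.
Proof. by move=> [_ [c [d [_ -> e]]]] /=; rewrite e. Qed.

(** Infinitely many half-guards at one position, of which a finite set always misses one. *)
Let tilted (x : R * R) (t : nat) : guard R :=
  (x, [set y | dotp (1, t%:R) x <= dotp (1, t%:R) y]).

Let tilted_inj x : injective (tilted x).
Proof.
have le s t : tilted x s = tilted x t -> (t <= s)%N.
  (* The test point is on the boundary line of the first half-plane, and in the second one only if
     [t <= s]. *)
  move=> [e]; have : [set y | dotp (1, s%:R) x <= dotp (1, s%:R) y] (x.1 + s%:R, x.2 - 1).
    by rewrite /dotp /=; lra.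
  by rewrite e /dotp /= -(ler_nat R); lra.
by move=> s t e; apply/eqP; rewrite eqn_leq !le.
Qed.

(* Half-guards at a common position see each other, whatever their half-planes. *)
Lemma add_half_guard (G : set (guard R)) k : cooperative_half_guard_set P G ->
  G !=set0 -> (G #= `I_k)%card ->
  exists G', [/\ cooperative_half_guard_set P G', G' !=set0 & (G' #= `I_k.+1)%card].
Proof.
move=> [hG mG vG] [g0 Gg0] cG.
have [t nt] : exists t, ~ G (tilted g0.1 t).
  apply/not_existsP => all; apply: infinite_nat.
  have fG : finite_set G by apply/finite_setP; exists k.
  have sub : range (tilted g0.1) `<=` G.
    by move=> _ [t _ <-]; apply: contrapT; apply: all.
  rewrite -(eq_finite_set (inj_card_eq (f := tilted g0.1) (A := setT) _)).
    exact: sub_finite_set sub fG.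
  by move=> s t _ _; apply: tilted_inj.
set g1 := tilted g0.1 t in nt.
have [P0 _] := hG _ Gg0.
have h1 : half_guard P g1.
  split=> //; exists (1, t%:R), (dotp (1, t%:R) g0.1); split=> //.
  by move=> [] /eqP; rewrite oner_eq0.
have m10 : mutually_visible P g1 g0.
  by split; rewrite /sees segment_xx => _ ->; split=> //; [exact: half_guard_mem h1|
    apply: half_guard_mem; apply: hG].
have m01 : mutually_visible P g0 g1 by case: m10.
exists (g1 |` G); split; last 2 first.
- by exists g0; right.
- apply/eq_cardSP; exists g1; first by left.
  rewrite (_ : _ `\ _ = G) //; apply/seteqP; split=> [g [[->|//] /(_ erefl)] //|g Gg].
  by split; [right|move=> e; apply: nt; rewrite -e].
split.
- by move=> g [->|/hG].
- by move=> y /mG[g Gg s]; exists g => //; right.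
have lift g h : G g -> G h -> clos_refl_trans (guard R)
    (fun g2 g3 => [/\ (g1 |` G) g2, (g1 |` G) g3 & mutually_visible P g2 g3]) g h.
  move=> Gg Gh; elim: (vG g h Gg Gh) => [p q [Gp Gq m]|p|p q r _ c1 _ c2].
  - by apply: rt_step; split=> //; right.
  - exact: rt_refl.
  - exact: rt_trans c1 c2.
have s10 : clos_refl_trans (guard R)
    (fun g2 g3 => [/\ (g1 |` G) g2, (g1 |` G) g3 & mutually_visible P g2 g3]) g1 g0.
  by apply: rt_step; split=> //; [left|right].
have s01 : clos_refl_trans (guard R)
    (fun g2 g3 => [/\ (g1 |` G) g2, (g1 |` G) g3 & mutually_visible P g2 g3]) g0 g1.
  by apply: rt_step; split=> //; [right|left].
move=> g h [->|Gg] [->|Gh].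
- exact: rt_refl.
- exact: rt_trans s10 (lift _ _ Gg0 Gh).
- exact: rt_trans (lift _ _ Gg Gg0) s01.
- exact: lift.
Qed.

Lemma exact_half_guards (G : set (guard R)) m : cooperative_half_guard_set P G ->
  G !=set0 -> (G #<= `I_m)%card ->
  exists G', cooperative_half_guard_set P G' /\ (G' #= `I_m)%card.
Proof.
move=> coG neG leG.
have /finite_setP[k cG] : finite_set G by apply/finite_set_leP; exists m.
have km : (k <= m)%N by rewrite -card_le_II -(card_le_eql cG).
suff : exists G', [/\ cooperative_half_guard_set P G', G' !=set0 & (G' #= `I_m)%card].
  by case=> G' [? _ ?]; exists G'.
rewrite -(subnKC km); elim: (m - k)%N => [|d [G' [c' n' e']]].
  by rewrite addn0; exists G.
by rewrite addnS; apply: add_half_guard c' n' e'.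
Qed.

End Padding.

(** * Lattice guards realised as half-guards *)

Section RealGuards.
Variables (R : realType) (w : R * R) (X Y : nat -> R).
Variables (I : nat -> nat -> bool).
Hypothesis w0 : w != 0.
Hypotheses (Xinc : {mono X : i j / (i < j)%N >-> i < j})
           (Yinc : {mono Y : i j / (i < j)%N >-> i < j}).
Let P : set (R * R) := [set z | exists x y, I x y /\ in_cell w X Y x y z].

(** Looking down takes the opposite normal, since half-planes have the form [c <= dotp a y]. *)
Definition real_guard (g : lguard) : guard R :=
  (point_at w (X g.1.1) (Y g.1.2),
   if g.2 then [set z | Y g.1.2 <= dotp (perp w) z]
   else [set z | - Y g.1.2 <= dotp (- perp w) z]).

Lemma real_guard_half g z :
  (real_guard g).2 z <-> if g.2 then Y g.1.2 <= coord w true z else coord w true z <= Y g.1.2.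
Proof.
rewrite /real_guard /coord; case: g.2 => //=.
have -> : dotp (- perp w) z = - dotp (perp w) z by rewrite /dotp /=; ring.
by rewrite lerN2.
Qed.

Definition in_box i1 i2 b a (z : R * R) :=
  X i1 <= coord w false z <= X i2.+1 /\ Y b <= coord w true z <= Y a.

Lemma rect_region i1 i2 b a z : rect I i1 i2 b a -> in_box i1 i2 b a z -> P z.
Proof.
move=> [le r] [hx hy].
have [x [hi hx']] := locate Xinc (le : (i1 < i2.+1)%N) hx.
have hi' : (i1 <= x <= i2)%N by lia.
have [ba rI _ _] := r x hi'.
have [y [hj hy']] := locate Yinc ba hy.
by exists x, y; split=> //; apply: rI.
Qed.

Lemma stands_in_box g i1 i2 b a : stands_in g i1 i2 b a -> in_box i1 i2 b a (real_guard g).1.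
Proof.
rewrite /stands_in => h; rewrite /in_box coordF_at // coordT_at // !(Xle Xinc) !(Xle Yinc).
by lia.
Qed.

Lemma rect_sees g i1 i2 b a z : rect I i1 i2 b a -> stands_in g i1 i2 b a ->
  in_box i1 i2 b a z -> (real_guard g).2 z -> sees P (real_guard g) z.
Proof.
move=> r /stands_in_box[gx gy] [zx zy] hz p s; split.
  by apply: rect_region r _; split; apply: (coord_segment s).
apply/real_guard_half; move/real_guard_half: hz => hz.
have gY : coord w true (real_guard g).1 = Y g.1.2 by rewrite coordT_at.
case: g.2 hz => hz.
  have := coord_segment (k := true) (w := w) (m := Y g.1.2) (M := Num.max (Y g.1.2) (coord w true z)) s.
  by rewrite gY hz lexx !le_max !lexx orbT => /(_ isT isT) /andP[].
have := coord_segment (k := true) (w := w) (m := Num.min (Y g.1.2) (coord w true z)) (M := Y g.1.2) s.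
by rewrite gY hz lexx !ge_min !lexx orbT => /(_ isT isT) /andP[].
Qed.

Lemma lsees_mutual g g' : lsees I g g' -> mutually_visible P (real_guard g) (real_guard g').
Proof.
move=> [i1 [i2 [b [a [r s s' f f']]]]].
have half h h' : faces h h'.1.2 -> (real_guard h).2 (real_guard h').1.
  move=> fh; apply/real_guard_half; rewrite coordT_at //.
  by move: fh; rewrite /faces; case: h.2; rewrite (Xle Yinc).
by split; apply: (rect_sees r) => //; try exact: stands_in_box; exact: half.
Qed.

Lemma covers_sees g x y z : covers I g x y -> in_cell w X Y x y z -> sees P (real_guard g) z.
Proof.
move=> [i1 [i2 [b [a [r s hi hj /andP[f1 f2]]]]]] [/andP[x1 x2] /andP[y1 y2]].
apply: (rect_sees r s).
  split; apply/andP; split.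
  - by apply: le_trans x1; rewrite (Xle Xinc); lia.
  - by apply: (le_trans x2); rewrite (Xle Xinc); lia.
  - by apply: le_trans y1; rewrite (Xle Yinc); lia.
  - by apply: (le_trans y2); rewrite (Xle Yinc); lia.
apply/real_guard_half; move: f1 f2; rewrite /faces; case: g.2 => f1 f2.
  by apply: le_trans y1; rewrite (Xle Yinc).
by apply: (le_trans y2); rewrite (Xle Yinc).
Qed.

Lemma perp_neq0 : perp w <> 0.
Proof.
move=> [/eqP]; rewrite oppr_eq0 => /eqP e2 e1.
by move/eqP: w0; apply; rewrite (surjective_pairing w) e1 e2.
Qed.

Lemma cooperative_real_guards (s : seq lguard) :
  {in s, forall g, exists i1 i2 b a, rect I i1 i2 b a /\ stands_in g i1 i2 b a} ->
  (forall x y, I x y -> exists2 g, g \in s & covers I g x y) ->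
  lconnected I s ->
  cooperative_half_guard_set P [set real_guard g | g in [set` s]].
Proof.
move=> pos cov con; split.
- move=> _ [g /pos[i1 [i2 [b [a [r st]]]]] <-]; split.
    exact: rect_region r (stands_in_box st).
  rewrite /real_guard /=; case: g.2.
    exists (perp w), (Y g.1.2); split=> //; first exact: perp_neq0.
    exact: coordT_at.
  exists (- perp w), (- Y g.1.2); split=> //.
    by move=> /eqP; rewrite oppr_eq0 => /eqP; apply: perp_neq0.
  rewrite -[in RHS](coordT_at w0 (X g.1.1) (Y g.1.2)) /coord /dotp /=; ring.
- move=> z [x [y [Ixy zc]]]; have [g gs cg] := cov x y Ixy.
  by exists (real_guard g); [exists g|exact: covers_sees cg zc].
move=> _ _ [g gs <-] [h hs <-].
elim: (con g h gs hs) => [p q [ps qs m]|p|p q r _ c1 _ c2].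
- by apply: rt_step; split; [exists p|exists q|exact: lsees_mutual].
- exact: rt_refl.
- exact: rt_trans c1 c2.
Qed.

End RealGuards.

(** * From an orthogonal polygon to a lattice polygon *)

Lemma increasing_enumeration (R : realType) (s : seq R) :
  exists X : nat -> R, {mono X : i j / (i < j)%N >-> i < j} /\
    forall x, x \in s -> exists k, (0 < k)%N /\ X k = x.
Proof.
(* The value added in front takes index 0, so that listed values have positive ranks. *)
pose s' := sort <=%R (undup s); pose q := (head 0 s' - 1) :: s'.
have qs : path <%R (head 0 s' - 1) s'.
  have : sorted <%R s' by rewrite /s' sort_lt_sorted undup_uniq.
  by case: s' {q} => //= y s' ->; rewrite gtrBl ltr01.
(* Beyond the list, unit steps keep the sequence increasing on all of [nat]. *)
pose X k := if (k < size q)%N then nth 0 q k else last 0 q + (k - size q).+1%:R.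
have step k : X k < X k.+1.
  rewrite /X; have [lt|ge] := ltnP k.+1 (size q).
    by rewrite ltnW //; move/(pathP 0): qs => /(_ k lt).
  have [lt|ge'] := ltnP k (size q).
    have -> : k = (size q).-1 by lia.
    by rewrite nth_last ltrDl ltr0Sn.
  by rewrite ltrD2l ltr_nat; lia.
have homo i d : X i < X (i + d).+1.
  by elim: d => [|d IH]; rewrite ?addn0 // addnS (lt_trans IH).
exists X; split=> [i j|x xs].
  have lt i' j' : (i' < j')%N -> X i' < X j'.
    by move=> h; have := homo i' (j' - i'.+1)%N; rewrite -addSn subnKC.
  have [/lt//|/lt h|->] := ltngtP i j; last by rewrite ltxx.
  by apply/negbTE; rewrite -leNgt ltW.
have xs' : x \in s' by rewrite mem_sort mem_undup.
exists (index x s').+1; split=> //.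
by rewrite /X /= ltnS index_mem xs' nth_index.
Qed.

(** One or three quarter turns, in either sense, give plus or minus [perp]; the sign goes into
    [k]. *)
Lemma interior_angle_perp (R : realType) n (v : 'I_n -> R * R) i :
  interior_angle v i (pi / 2) \/ interior_angle v i (3 * pi / 2) ->
  exists2 k : R, k != 0 & v (ord_pred i) - v i = k *: perp (v (ordS i) - v i).
Proof.
have c2 : cos (pi / 2) = 0 :> R := cos_pihalf R.
have s2 : sin (pi / 2) = 1 :> R := sin_pihalf R.
have e3 : 3 * pi / 2 = pi / 2 + pi :> R by field.
have c3 : cos (3 * pi / 2) = 0 :> R by rewrite e3 cosDpi c2 oppr0.
have s3 : sin (3 * pi / 2) = -1 :> R by rewrite e3 sinDpi s2.
by case=> -[_ [[] [[rho rho0 E] _]]]; move: E; rewrite /rotate /perp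
  ?expr1 ?expr0 ?mul1r ?mulN1r ?cosN ?sinN ?c2 ?s2 ?c3 ?s3 ?opprK => E;
  [exists (- rho)|exists rho|exists rho|exists (- rho)];
  rewrite ?oppr_eq0 ?gt_eqF // E; congr pair; rewrite /GRing.scale /=; ring.
Qed.

Lemma orthogonal_lattice (R : realType) n (v : 'I_n -> R * R) :
  orthogonal_polygon v -> exists w X Y a b,
  [/\ w != 0, {mono X : i j / (i < j)%N >-> i < j},
      {mono Y : i j / (i < j)%N >-> i < j},
      forall i, coord w false (v i) = X (a i) /\ coord w true (v i) = Y (b i)
    & lattice_polygon a b].
Proof.
move=> [[n3 vne vcons vdisj] orth].
have n0 : (0 < n)%N by lia.
pose d i := v (ordS i) - v i.
have dne i : d i != 0 by rewrite subr_eq0 eq_sym; apply/eqP/vne.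
pose w := d (Ordinal n0).
have w0 : w != 0 := dne _.
have dE k i : coord w k (d i) = coord w k (v (ordS i)) - coord w k (v i).
  by rewrite /d; case: k; rewrite /coord /dotp /=; ring.
have turn i : exists2 k : R, k != 0 & d (ordS i) = k *: perp (d i).
  have [k k0] := interior_angle_perp (orth (ordS i)); rewrite ordSK => E.
  exists k^-1; first by rewrite invr_eq0.
  have -> : d i = - k *: perp (d (ordS i)) by rewrite scaleNr -E opprB.
  case: (d (ordS i)) => d1 d2; rewrite /perp /GRing.scale /= /GRing.scale /=.
  by congr pair; rewrite /GRing.scale /=; field.
have flip i : (coord w false (d (ordS i)) == 0) = (coord w true (d i) == 0) /\
              (coord w true (d (ordS i)) == 0) = (coord w false (d i) == 0).
  have [k k0 ->] := turn i.
  have -> : coord w false (k *: perp (d i)) = - k * coord w true (d i).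
    by rewrite /coord /dotp /perp /= /GRing.scale /=; ring.
  have -> : coord w true (k *: perp (d i)) = k * coord w false (d i).
    by rewrite /coord /dotp /perp /= /GRing.scale /=; ring.
  by rewrite !mulf_eq0 oppr_eq0 (negbTE k0).
(* The first side is [w] itself, and each turn exchanges the two directions. *)
have axis i : (coord w false (d i) == 0) = (coord w true (d i) != 0).
  apply: (ordS_transitive (P := fun i => (coord w false (d i) == 0) = (coord w true (d i) != 0)))
    (Ordinal n0) i _ => [i|].
    by have [-> ->] := flip i; case: eqP; case: eqP.
  have -> : coord w true (d (Ordinal n0)) = 0.
    by rewrite -/w /coord /dotp /perp /=; ring.
  rewrite eqxx; apply/negbTE; rewrite -/w /coord /dotp.
  apply: contra w0 => /eqP e; apply/eqP.
  have [e1 e2] : w.1 = 0 /\ w.2 = 0 by split; nra.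
  by rewrite (surjective_pairing w) e1 e2.
have enum k : exists X : nat -> R, {mono X : i j / (i < j)%N >-> i < j} /\
    exists a : 'I_n -> nat, forall i, (0 < a i)%N /\ X (a i) = coord w k (v i).
  have [X [Xinc hX]] := increasing_enumeration [seq coord w k (v i) | i <- enum 'I_n].
  have /choice[a ha] : forall i, exists j, (0 < j)%N /\ X j = coord w k (v i).
    by move=> i; apply: hX; apply: (map_f (fun i => coord w k (v i))); rewrite mem_enum.
  by exists X; split=> //; exists a.
have [X [Xinc [a ha]]] := enum false; have [Y [Yinc [b hb]]] := enum true.
have aE i j : (a i == a j) = (coord w false (v j) - coord w false (v i) == 0).
  by rewrite subr_eq0 eq_sym -!(proj2 (ha _)) (inj_eq (Xinj Xinc)).
have bE i j : (b i == b j) = (coord w true (v j) - coord w true (v i) == 0).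
  by rewrite subr_eq0 eq_sym -!(proj2 (hb _)) (inj_eq (Xinj Yinc)).
have ax i : (a i == a (ordS i)) = (b i != b (ordS i)) by rewrite aE bE -!dE.
have va i : coord w false (v i) = X (a i) by rewrite (proj2 (ha i)).
have vb i : coord w true (v i) = Y (b i) by rewrite (proj2 (hb i)).
exists w, X, Y, a, b; split=> //; split=> //.
- by move=> i; rewrite (proj1 (ha i)) (proj1 (hb i)).
- move=> i; rewrite [in RHS]ax negbK aE bE -!dE.
  by have [_ ->] := flip i.
move=> i j x y ij oi oj.
have bt (Z : nat -> R) (p q r : nat) : {mono Z : i j / (i < j)%N >-> i < j} ->
    (minn p q <= r <= maxn p q)%N -> between (Z p) (Z q) (Z r).
  by move=> Zinc; rewrite /between !(Xle Zinc); lia.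
have on_real k : on_side a b k x y -> side v k (point_at w (X x) (Y y)).
  move=> /andP[p1 p2]; apply/(side_coordP w0 Xinc Yinc va vb ax).
  by rewrite coordF_at // coordT_at //; split; apply: bt.
have si := on_real i oi; have sj := on_real j oj.
have eqv k : point_at w (X x) (Y y) = v k -> (x, y) = (a k, b k).
  move=> e; congr pair; first by apply: (Xinj Xinc); rewrite -va -e coordF_at.
  by apply: (Xinj Yinc); rewrite -vb -e coordT_at.
have [e|nj] := eqVneq j (ordS i).
  left; split=> //; apply: eqv.
  have : (side v i `&` side v (ordS i)) (point_at w (X x) (Y y)) by rewrite -e.
  by rewrite vcons -e.
have [e|ni] := eqVneq i (ordS j).
  right; split=> //; apply: eqv.
  have : (side v j `&` side v (ordS j)) (point_at w (X x) (Y y)) by rewrite -e.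
  by rewrite vcons -e.
have : (side v i `&` side v j) (point_at w (X x) (Y y)) by [].
by rewrite vdisj //; apply/eqP.
Qed.

Theorem theorem7p1 (R : realType) (n : nat) (v : 'I_n -> R * R)
    (hn : (6 <= n)%N) (hP : orthogonal_polygon v) :
  exists G : set (guard R),
    cooperative_half_guard_set (polygon_region v) G /\
    (G #= `I_(n./2 - 2))%card.
Proof.
have [w [X [Y [a [b [w0 Xinc Yinc vab lp]]]]]] := orthogonal_lattice hP.
have va i := proj1 (vab i); have vb i := proj2 (vab i).
have n0 : (0 < n)%N by lia.
have [x1 [y1 I1]] := cell_exists lp (Ordinal n0).
have /= rc := reflex_count lp (Ordinal n0).
have [s [ss pos cov con]] := lattice_guards (cell_in_box lp) (cell_connected lp) I1.
rewrite (region_cells w0 Xinc Yinc va vb lp).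
have co := cooperative_real_guards w0 Xinc Yinc pos cov con.
apply: (exact_half_guards co).
  have s0 : (0 < size s)%N by case/andP: ss.
  by exists (real_guard w X Y (nth (0, 0, true)%N s 0)), (nth (0, 0, true)%N s 0) => //;
    apply: mem_nth.
apply: card_le_trans (card_image_le _ _) _.
have sm : (size s <= n./2 - 2)%N.
  have bound r : (2 * r + 4 <= n -> maxn 1 r <= n./2 - 2)%N by lia.
  by case/andP: ss => _ /leq_trans; apply; apply: bound rc.
(* Indices beyond [size s] yield the default guard, harmless since an inclusion is enough. *)
have sub : [set` s] `<=` nth (0, 0, true)%N s @` `I_(n./2 - 2).
  move=> g gs; exists (index g s); last by rewrite nth_index.
  by apply: leq_trans sm; rewrite index_mem.
exact: card_le_trans (subset_card_le sub) (card_image_le _ _).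
Qed.
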